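(* Let $n\ge 1$, let $V\subseteq \mathbb{C}^{2n}$ be an irreducible algebraic variety, and let $\pi:\mathbb{C}^{2n}\to\mathbb{C}^n$ be the projection onto the first $n$ coordinates. If $\pi(V)$ is Zariski dense in $\mathbb{C}^n$, then $\pi(E_j^n\cap V)$ is Zariski dense in $\mathbb{C}^n$. In particular, $V$ contains infinitely many points of the form $(z_1,\ldots,z_n,j(z_1),\ldots,j(z_n))$ with $z_1,\ldots,z_n\in\mathbb{H}$.
   Context: $\mathbb{H}=\{z\in\mathbb{C}:\mathrm{Im}(z)>0\}$. The modular $j$ function is the unique holomorphic function $j:\mathbb{H}\to\mathbb{C}$ invariant under the action of $\mathrm{SL}_2(\mathbb{Z})$ by Möbius transformations and having a Fourier expansion $j(z)=q^{-1}+\sum_{k\ge0}a_kq^k$ with $q=\exp(2\pi i z)$. For $n\ge1$, $E_j^n:=\{(z_1,\ldots,z_n,j(z_1),\ldots,j(z_n)):z_1,\ldots,z_n\in\mathbb{H}\}$. *)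

(* Defs.v *)
From mathcomp Require Import all_boot all_order all_algebra.
From mathcomp Require Import all_classical all_reals all_analysis.
From mathcomp Require Export complex.
(* mpoly is not imported: its notations clash with those of analysis. *)
From mathcomp Require mpoly.

Set Implicit Arguments.
Unset Strict Implicit.
Unset Printing Implicit Defensive.

Import Order.TTheory GRing.Theory Num.Theory.
Import numFieldNormedType.Exports.

Local Open Scope classical_set_scope.
Local Open Scope complex_scope.
Local Open Scope ring_scope.

Section Zariski.
Variables (K : fieldType) (m : nat).

Definition zero_locus (P : set (mpoly.mpoly m K)) : set 'rV[K]_m :=
  [set x | forall p, P p -> mpoly.meval (fun i => x ord0 i) p = 0].

Definition zariski_closed (V : set 'rV[K]_m) : Prop :=
  exists P : set (mpoly.mpoly m K), V = zero_locus P.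

Definition zariski_closure (S : set 'rV[K]_m) : set 'rV[K]_m :=
  smallest zariski_closed S.

Definition zariski_dense (S : set 'rV[K]_m) : Prop :=
  zariski_closure S = setT.

Definition irreducible_variety (V : set 'rV[K]_m) : Prop :=
  [/\ zariski_closed V, V !=set0 &
      forall A B : set 'rV[K]_m, zariski_closed A -> zariski_closed B ->
        V = A `|` B -> V = A \/ V = B].

End Zariski.

Section ModularJ.
Variable R : realType.
Local Notation C := R[i].

Definition upper_half_plane : set C := [set z | 0 < complex.Im z].

Definition cexp (z : C) : C :=
  (expR (complex.Re z))%:C *
  (cos (complex.Im z) +i* sin (complex.Im z)).

Definition nome (z : C) : C := cexp (2 * pi%:C * 'i * z).

Definition moebius (g : 'M[int]_2) (z : C) : C :=
  ((g 0 0)%:~R * z + (g 0 1)%:~R) / ((g 1 0)%:~R * z + (g 1 1)%:~R).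

(* C^o carries the topology of the modulus and is a normed space over C
   itself, so derivability in the direction 1 is complex differentiability. *)
Definition holomorphic_on (D : set C) (f : C -> C) : Prop :=
  forall z, D z -> derivable (f : C^o -> C^o) z 1.

Definition SL2Z_invariant (f : C -> C) : Prop :=
  forall (g : 'M[int]_2) (z : C), \det g = 1 -> upper_half_plane z ->
    f (moebius g z) = f z.

Definition has_j_expansion (f : C -> C) : Prop :=
  exists a : nat -> C, forall z, upper_half_plane z ->
    (fun N => (nome z)^-1 + \sum_(0 <= k < N) a k * nome z ^+ k : C^o)
      @ \oo --> (f z : C^o).

(* Only the values on the upper half-plane matter.  The constant term a 0 is
   left free, so this holds of the j function (a 0 = 744) and its translates
   by constants. *)
Definition is_modular_j (j : C -> C) : Prop :=
  [/\ holomorphic_on upper_half_plane j, SL2Z_invariant j & has_j_expansion j].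

Definition graph_j (j : C -> C) (n : nat) : set 'rV[C]_(n + n) :=
  [set row_mx z (map_mx j z) |
    z in [set z : 'rV[C]_n | forall i, upper_half_plane (z ord0 i)]].

Definition proj_first (n : nat) (v : 'rV[C]_(n + n)) : 'rV[C]_n := lsubmx v.

End ModularJ.

Arguments graph_j {R} j n.
Arguments proj_first {R} n v.

(* Main.v *)
Require Import Defs.
From mathcomp Require Import all_boot all_order all_algebra.
From mathcomp Require Import all_classical all_reals all_analysis.
From mathcomp Require Import complex.
From mathcomp Require Import ring lra.
Import -(notations) mpoly.

(* Near an integer point x of R^n the variety carries a locally Lipschitz section
   z |-> (z, y(z)): this is elimination theory for the prime ideal of V (free
   y-coordinates are frozen at integers, algebraic ones are simple roots), and
   n-tuples of integers are Zariski dense.  The Moebius maps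
   t |-> x - 1/(t + k), k an integer, come from SL_2(Z), so they preserve j, while
   for large k they send a neighbourhood of any given point into a tiny
   neighbourhood of x.  Hence the system j(z_i) = y_i(z) becomes
   j(t_i) = y_i(x - 1/(t + k)), a small perturbation of j(t_i) = y_i(x), which is
   solved by contraction as soon as j is onto C and y_i(x) avoids the finitely many
   critical values of j (or y_i is constant).  The facts on j come from its
   q-expansion: j = P(q)/q with P a power series, every point is equivalent to
   one with |q| <= 1/7, and |j - c| attains its minimum over the upper half-plane,
   which must be 0 since |j - c| has no nonzero local minimum. *)

Set Implicit Arguments.
Unset Strict Implicit.
Unset Printing Implicit Defensive.

Import Order.TTheory GRing.Theory Num.Theory.
Import numFieldNormedType.Exports.

Local Open Scope classical_set_scope.
Local Open Scope complex_scope.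
Local Open Scope ring_scope.

(** An integer point lies on the real line, outside the domain of $j$; it serves only as a cusp to
    which translates of interior points accumulate, so the growth of $j$ near the real line never
    enters. Density asks for more than one solution. A nonzero polynomial $F$ in the $z_i$ is
    therefore fixed in advance and the section is chosen inside $F \ne 0$; this polynomial travels
    through the elimination together with the vanishing ideal. The same device keeps $y_i(x)$ away
    from critical values: for each exceptional value $e$ the factor $y_i - e$ is multiplied into
    $F$, unless it vanishes on all of $V$, in which case $y_i$ is constant and no derivative of $j$
    is required. Sections are merely Lipschitz because the contraction, with frozen slope, needs
    strict differentiability of $j$ in one variable and nothing holomorphic in several. Convergence
    comes with the rate $2^{-k}$, so that identities between limits reduce to inequalities between
    moduli. *)

(** * Elimination of one variable from a prime ideal *)

Section PrimeIdealElimination.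
Variables (B : idomainType) (J : set {poly B}).
Hypotheses (JD : forall p q, J p -> J q -> J (p + q)).
Hypotheses (JM : forall p q, J q -> J (p * q)).
Hypotheses (J0 : J 0).
Hypotheses (Jprime : forall p q, J (p * q) -> J p \/ J q).
Hypotheses (Jchar : forall n, ~ J n.+1%:R).

Let I : set B := [set b | J b%:P].
Let coefI (p : {poly B}) := forall i, I p`_i.

Let JB p q : J p -> J q -> J (p - q).
Proof. by move=> Jp Jq; apply: JD => //; rewrite -mulN1r; apply: JM. Qed.

Let Jexp p k : J (p ^+ k) -> J p.
Proof.
elim: k => [|k IH]; first by move=> /(JM p); rewrite mulr1.
by rewrite exprS => /Jprime[].
Qed.

Let coefI_J p : coefI p -> J p.
Proof.
move=> Ip; rewrite -[p]coefK poly_def.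
elim/big_ind: _ => // i _; rewrite -mul_polyC mulrC; apply: JM; apply: Ip.
Qed.

Let coefIB p q : coefI p -> coefI q -> coefI (p - q).
Proof. by move=> hp hq i; rewrite /I /= coefB polyCB; apply: JB; [apply: hp|apply: hq]. Qed.

Let coefIM p q : coefI q -> coefI (p * q).
Proof.
move=> hq i; rewrite /I /= coefM rmorph_sum /=.
by elim/big_ind: _ => // k _; rewrite polyCM; apply: JM; apply: hq.
Qed.

(** Leading terms with coefficient in [I] are stripped one at a time; modulo [J] nothing changes,
    and the leading coefficient that remains is nonzero in [B/I]. *)
Let truncI p : ~ coefI p ->
  exists p', [/\ coefI (p - p'), ~ I (lead_coef p') & (size p' <= size p)%N].
Proof.
move: {2}(size p) (leqnn (size p)) => n.
elim: n p => [|n IH] p.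
  rewrite leqn0 size_poly_eq0 => /eqP-> []; move=> i; rewrite coef0 /I /= polyC0; exact: J0.
move=> sp nI.
have [Il|nIl] := pselect (I (lead_coef p)); last first.
  by exists p; split=> //; rewrite subrr => i; rewrite coef0 /I /= polyC0; exact: J0.
have p0 : p != 0 by apply/eqP => p0; apply: nI => i; rewrite p0 coef0 /I /= polyC0; exact: J0.
pose m := lead_coef p *: 'X^((size p).-1).
have Im : coefI m.
  by move=> i; rewrite /m /I /= coefZ coefXn mulrC polyCM; apply: JM.
have sz : (size (p - m)%R < size p)%N.
  have sp0 : (0 < size p)%N by rewrite size_poly_gt0.
  rewrite -(prednK sp0) ltnS; apply/leq_sizeP => i hi.
  rewrite coefB coefZ coefXn.
  move: hi; rewrite leq_eqVlt => /orP[/eqP <-|hi]; first by rewrite eqxx mulr1 subrr.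
  by rewrite gtn_eqF // mulr0 subr0 nth_default // -(prednK sp0).
have nI' : ~ coefI (p - m).
  (* Here $p = (p - m) - (m - m - m)$: sums are expressed through closure under subtraction. *)
  move=> h; apply: nI; move=> i; have := coefIB h (fun i => (coefIB (coefIB Im Im) Im) i).
  by move=> /(_ i); rewrite subrr sub0r opprK subrK.
have /IH : (size (p - m)%R <= n)%N by rewrite -ltnS (leq_trans sz).
case=> // p' [h1 h2 h3]; exists p'; split=> //; last exact: leq_trans h3 (ltnW sz).
have -> : p - p' = (p - m - p') - (m - m - m).
  by rewrite subrr sub0r opprK addrAC subrK.
by apply: coefIB => //; apply: coefIB => //; apply: coefIB.
Qed.

(** [I] is the contraction of [J] to [B]. Either [X] stays transcendental over the fraction field of
    [B/I], or it is algebraic and [mu] is its minimal polynomial with denominators cleared: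
    separable because the characteristic is zero, and such that each [F] outside [J] has an inverse
    [a / e]. Pseudo-division replaces division in the fraction field. *)
Lemma prime_ideal_elimination :
  (forall p, J p -> forall i, J (p`_i)%:P) \/
  exists mu, [/\ J mu, ~ J (lead_coef mu)%:P, (1 < size mu)%N, ~ J mu^`()
   & (forall p, J p -> exists k q,
        forall i, J ((lead_coef mu ^+ k *: p - q * mu)`_i)%:P) /\
     (forall F, ~ J F -> exists a e, ~ J e%:P /\ J (e%:P - F * a))].
Proof.
have [H|/existsNP[p0 /not_implyP[Jp0 nI0]]] :=
  pselect (forall p, J p -> coefI p); first by left.
right.
(* [mu] has least degree among the members of [J] whose leading coefficient is outside [I]. *)
pose Q n := exists2 p, J p /\ ~ I (lead_coef p) & size p = n.
have exQ : exists n, `[<Q n>].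
  have [p' [h1 h2 h3]] := truncI nI0.
  exists (size p'); apply/asboolP; exists p' => //; split=> //.
  by rewrite -[p'](subKr p0); apply: JB => //; exact: coefI_J.
case: (ex_minnP exQ) => n /asboolP[mu [Jmu nlmu] smu] minmu.
have small p : J p -> (size p < size mu)%N -> coefI p.
  move=> Jp sp; apply: contrapT => nI.
  have [p' [h1 h2 h3]] := truncI nI.
  have : (n <= size p')%N.
    apply: minmu; apply/asboolP; exists p' => //; split=> //.
    by rewrite -[p'](subKr p); apply: JB => //; exact: coefI_J.
  by rewrite -smu leqNgt (leq_ltn_trans h3 sp).
have mu0 : mu != 0 by apply/eqP => h; apply: nlmu; rewrite h lead_coef0 /I /= polyC0.
have smu1 : (1 < size mu)%N.
  rewrite ltnNge; apply/negP => /size1_polyC h; apply: nlmu.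
  by rewrite h lead_coefC /I /= -h.
have div p : J p -> coefI (lead_coef mu ^+ Pdiv.Ring.rscalp p mu *: p
                           - Pdiv.Ring.rdivp p mu * mu).
  move=> Jp; rewrite (Pdiv.ComRing.rdivp_eq mu p) addrC addKr; apply: small.
    rewrite -(addKr (Pdiv.Ring.rdivp p mu * mu) (Pdiv.Ring.rmodp p mu)) addrC.
    rewrite -(Pdiv.ComRing.rdivp_eq mu p); apply: JB; last exact: JM.
    by rewrite -mul_polyC; apply: JM.
  by rewrite Pdiv.Ring.ltn_rmodp.
exists mu; split=> //.
- move=> /small; rewrite lt_size_deriv// => /(_ isT) /(_ (size mu).-2).
  rewrite coef_deriv /I /= -[(size mu).-2.+1](_ : (size mu).-1 = _); last first.
    by move: smu1; case: (size mu) => [|[]].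
  rewrite -/(lead_coef mu) -mulr_natr polyCM => /Jprime[//|].
  move: smu1; case: (size mu) => [|[|k]] //= _; rewrite -mulr_natr mul1r polyC_natr.
  exact: Jchar.
split.
  by move=> p Jp; exists (Pdiv.Ring.rscalp p mu), (Pdiv.Ring.rdivp p mu); exact: div.
move=> F nJF.
(* [K] is the ideal generated by [F] modulo [J]. Among its members outside [J] with leading
   coefficient outside [I], one of least degree turns out to be constant; it is [e]. *)
pose K (G : {poly B}) := exists a, J (G - F * a).
have KJ G a b : K G -> J (G * a - b) -> K b.
  move=> [c hc] h; exists (c * a).
  have -> : b - F * (c * a) = (a * (G - F * c)) - (G * a - b).
    by ring.
  by apply: JB => //; apply: JM.
pose good p := [/\ K p, ~ J p & ~ I (lead_coef p)].
have trK G : K G -> ~ J G -> exists2 G', good G' & (size G' <= size G)%N.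
  move=> KG nJG; have nI : ~ coefI G by move=> /coefI_J.
  have [G' [h1 h2 h3]] := truncI nI.
  exists G' => //; split=> //.
    by apply: (@KJ G 1) => //; rewrite mulr1; apply: coefI_J.
  by move=> JG'; apply: nJG; rewrite -[G](subrK G'); apply: JD => //; apply: coefI_J.
have exQ' : exists n, `[< exists2 p, good p & size p = n >].
  have KF : K F by exists 1; rewrite mulr1 subrr.
  have [G h1 h2] := trK F KF nJF.
  by exists (size G); apply/asboolP; exists G.
case: (ex_minnP exQ') => m /asboolP[G [KG nJG nlG] sG] minG.
have minG' H : K H -> (size H < size G)%N -> J H.
  move=> KH sH; apply: contrapT => /(trK H KH)[G' h1 h2].
  have : (m <= size G')%N by apply: minG; apply/asboolP; exists G'.
  by rewrite -sG leqNgt (leq_ltn_trans h2 sH).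
have G0 : G != 0 by apply/eqP => h; apply: nlG; rewrite h lead_coef0 /I /= polyC0.
have [sG1|sG1] := leqP (size G) 1.
  have [a ha] := KG; exists a, (lead_coef G); split=> //.
  by rewrite (size1_polyC sG1) lead_coefC -(size1_polyC sG1).
(* A [G] of positive degree would split [mu] modulo [I]: the remainder of [mu] by [G] lies in [J] by
   minimality of [G], hence so does the quotient; both are shorter than [mu], so their coefficients
   are in [I], and so are those of [lead_coef G ^+ k *: mu], which is absurd. *)
exfalso.
have sGmu : (size G <= size mu)%N.
  rewrite leqNgt; apply/negP => slt.
  have E := Pdiv.ComRing.rdivp_eq mu G.
  have JR : J (Pdiv.Ring.rmodp G mu).
    apply: minG'; last by rewrite (ltn_trans _ slt)// Pdiv.Ring.ltn_rmodp.
    apply: (@KJ G (lead_coef mu ^+ Pdiv.Ring.rscalp G mu)%:P) => //.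
    by rewrite mulrC mul_polyC E addrK; apply: JM.
  have : J (lead_coef mu ^+ Pdiv.Ring.rscalp G mu *: G).
    by rewrite E; apply: JD => //; apply: JM.
  by rewrite -mul_polyC rmorphXn => /Jprime[/Jexp|].
have E := Pdiv.ComRing.rdivp_eq G mu.
set k := Pdiv.Ring.rscalp mu G in E; set q := Pdiv.Ring.rdivp mu G in E.
set r := Pdiv.Ring.rmodp mu G in E.
have sr : (size r < size G)%N by rewrite Pdiv.Ring.ltn_rmodp.
have Er : r = lead_coef G ^+ k *: mu - q * G by rewrite E addrC addKr.
have Kr : K r.
  apply: (@KJ G (- q)) => //.
  have -> : G * - q - r = (- (lead_coef G ^+ k)%:P) * mu by rewrite Er -mul_polyC; ring.
  exact: JM.
have Jr : J r by apply: minG'.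
have Ir : coefI r by apply: small => //; apply: leq_trans sGmu.
have Jq : J q.
  have : J (q * G).
    rewrite -[q * G](addrK r) -E -mul_polyC; apply: JB => //; exact: JM.
  by case/Jprime.
have Iq : coefI q.
  apply: small => //; have [->|q0] := eqVneq q 0; first by rewrite size_poly0 ltnW.
  have : (size (q * G)%R <= size mu)%N.
    rewrite -[q * G](addrK r) -E (leq_trans (size_polyD _ _))// geq_max size_polyN.
    by rewrite size_scale_leq (leq_trans (ltnW sr)).
  rewrite size_mul//; move: sG1; case: (size G) => [|[|g]] // _.
  by rewrite !addnS /= => h; apply: leq_trans h; rewrite ltnS leq_addr.
have : coefI (lead_coef G ^+ k *: mu).
  have -> : lead_coef G ^+ k *: mu = G * q - (r - r - r).
    by rewrite E subrr sub0r opprK mulrC.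
  by apply: coefIB; [apply: coefIM|apply: coefIB => //; apply: coefIB].
move=> /(_ (size mu).-1); rewrite coefZ /I /= polyCM => /Jprime[|//].
by rewrite rmorphXn => /Jexp.
Qed.
End PrimeIdealElimination.

(** * Polynomials in several variables as a tower of univariate ones *)

Fixpoint itpoly (K : idomainType) (m : nat) : idomainType :=
  if m is m'.+1 then {poly (itpoly K m')} : idomainType else K.

(** The last variable of the tower is the outermost, so that adjoining a coordinate is one step of
    [{poly _}] over a domain. Points are infinite sequences of which only the first [m] entries are
    read; one point thus serves every level of the tower. *)
Fixpoint evi (K : idomainType) (v : nat -> K) (m : nat) :
    {rmorphism itpoly K m -> K} :=
  match m return {rmorphism itpoly K m -> K} with
  | 0 => idfun
  | m'.+1 => horner_eval (v m') \o map_poly (evi v m')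
  end.

Section IteratedPolynomials.
Variable K : idomainType.
Implicit Types v w : nat -> K.

Lemma eviS v m (p : itpoly K m.+1) :
  evi v m.+1 p = (map_poly (evi v m) p).[v m].
Proof. by []. Qed.

Lemma evi_sum v m (p : {poly itpoly K m}) :
  evi v m.+1 p = \sum_(i < size p) evi v m p`_i * v m ^+ i.
Proof.
rewrite eviS (@horner_coef_wide _ (size p)); last exact: size_poly.
by apply: eq_bigr => i _; rewrite coef_map.
Qed.

Lemma eviC v m (c : itpoly K m) : evi v m.+1 (c%:P : {poly itpoly K m}) = evi v m c.
Proof. by rewrite eviS map_polyC hornerC. Qed.

Lemma eq_evi v w m (p : itpoly K m) :
  (forall i, (i < m)%N -> v i = w i) -> evi v m p = evi w m p.
Proof.
elim: m p => [//|m IH] p vw; rewrite !evi_sum; apply: eq_bigr => i _.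
by rewrite (vw m)// (IH p`_i)// => k km; apply: vw; apply: ltnW.
Qed.

Lemma itpolyC m (c : K) : exists f : itpoly K m, forall v, evi v m f = c.
Proof.
elim: m => [|m [f hf]]; first by exists c.
by exists (f%:P : {poly itpoly K m}) => v; rewrite eviC.
Qed.

Lemma itpolyX m i : (i < m)%N -> exists f : itpoly K m, forall v, evi v m f = v i.
Proof.
elim: m => [//|m IH]; rewrite ltnS leq_eqVlt => /orP[/eqP->|/IH[f hf]].
  by exists ('X : {poly itpoly K m}) => v; rewrite eviS map_polyX hornerX.
by exists (f%:P : {poly itpoly K m}) => v; rewrite eviC.
Qed.

Lemma itpoly_of_mpoly m (p : mpoly.mpoly m K) :
  exists f : itpoly K m, forall v, evi v m f = mpoly.meval (fun i => v (val i)) p.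
Proof.
pose X (i : 'I_m) := sval (cid (itpolyX (ltn_ord i))).
pose c a := sval (cid (@itpolyC m a)).
exists (\sum_(mm <- mpoly.msupp p)
  c (mpoly.mcoeff mm p) * \prod_i X i ^+ mpoly.fun_of_multinom mm i) => v.
rewrite mpoly.mevalE rmorph_sum; apply: eq_bigr => mm _.
rewrite rmorphM rmorph_prod /= (svalP (cid (@itpolyC m _)) v); congr (_ * _).
apply: eq_bigr => i _; rewrite rmorphXn /=; congr (_ ^+ _).
by rewrite /X (svalP (cid (itpolyX (ltn_ord i))) v).
Qed.

Lemma mpoly_of_itpoly M m (f : itpoly K m) : (m <= M)%N ->
  exists p : mpoly.mpoly M K, forall v,
    mpoly.meval (fun i => v (val i)) p = evi v m f.
Proof.
elim: m f => [|m IH] f mM; first by exists (mpoly.mpolyC M f) => v; rewrite mpoly.mevalC.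
pose q i := sval (cid (IH (f : {poly itpoly K m})`_i (ltnW mM))).
exists (\sum_(i < size (f : {poly itpoly K m}))
  q i * mpoly.mpolyX K (mpoly.mnm1 (Ordinal mM)) ^+ i) => v.
rewrite evi_sum rmorph_sum; apply: eq_bigr => i _ /=.
rewrite rmorphM rmorphXn /= mpoly.mevalXU; congr (_ * _).
exact: (svalP (cid (IH (f : {poly itpoly K m})`_i (ltnW mM))) v).
Qed.

End IteratedPolynomials.

Arguments evi : simpl never.
Arguments itpoly : simpl never.

Lemma poly_natroots (K : numDomainType) (p : {poly K}) :
  (forall k : nat, p.[k%:R] = 0) -> p = 0.
Proof.
move=> h; apply/eqP; apply: contraT => p0.
have := @max_poly_roots _ p [seq k%:R | k <- iota 0 (size p)] p0.
rewrite size_map size_iota ltnn; apply; first by apply/allP => _ /mapP[k _ ->]; apply/rootP.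
by rewrite map_inj_uniq ?iota_uniq// => a b /eqP; rewrite eqr_nat => /eqP.
Qed.

(** Freezing all variables but the last at natural numbers leaves a univariate polynomial with
    infinitely many roots, hence zero; induction then applies to the coefficients. *)
Lemma itpoly_natpoints (K : numDomainType) m (f : itpoly K m) :
  (forall k : nat -> nat, evi (fun i => (k i)%:R) m f = 0) -> f = 0.
Proof.
elim: m f => [|m IH] f hf; first exact: (hf (fun=> 0%N)).
apply/polyP => i; rewrite coef0; apply: IH => k.
suff /polyP/(_ i) : map_poly (evi (fun i => (k i)%:R) m) (f : {poly itpoly K m}) = 0.
  by rewrite coef_map coef0.
apply: poly_natroots => a.
have := hf (fun j => if (j < m)%N then k j else a); rewrite eviS ltnn => <-.
congr (_.[_]); apply: eq_map_poly => c; apply: eq_evi => j jm.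
by rewrite jm.
Qed.

(** * Geometric convergence, contraction and locally Lipschitz functions *)

Section Modulus.
Variable R : realType.
Local Notation C := R[i].
Local Notation nm := (@Normc.normc R).

(** The norm of [R[i]] takes its values in [R[i]]; estimates use the real number [nm z], on which
    [lra] can work. *)
Lemma nmE z : `|z| = (nm z)%:C.
Proof. by []. Qed.

Lemma nm_ge0 z : 0 <= nm z.
Proof. by case: z => a b; apply: sqrtr_ge0. Qed.

Lemma nm0 : nm 0 = 0.
Proof. exact: Normc.normc0. Qed.

Lemma nmM z w : nm (z * w) = nm z * nm w.
Proof. exact: Normc.normcM. Qed.

Lemma nmN z : nm (- z) = nm z.
Proof. exact: normcN. Qed.

Lemma nmV z : nm z^-1 = (nm z)^-1.
Proof. exact: Normc.normcV. Qed.

Lemma nmX z k : nm (z ^+ k) = nm z ^+ k.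
Proof.
elim: k => [|k IH]; first by rewrite !expr0 Normc.normc1.
by rewrite !exprS nmM IH.
Qed.

Lemma nmD z w : nm (z + w) <= nm z + nm w.
Proof. exact: le_normcD. Qed.

Lemma nmB z w : nm (z - w) <= nm z + nm w.
Proof. by rewrite -(nmN w); exact: nmD. Qed.

Lemma nmBC z w : nm (z - w) = nm (w - z).
Proof. by rewrite -nmN opprB. Qed.

Lemma nm_tri z y w : nm (z - w) <= nm (z - y) + nm (y - w).
Proof. by rewrite -[z - w](subrKA y); exact: nmD. Qed.

Lemma nm_triB z w : nm z - nm w <= nm (z - w).
Proof. by rewrite lerBlDr -{1}[z](subrK w); exact: nmD. Qed.

Lemma nm_eq0 z : (nm z == 0) = (z == 0).
Proof. by apply/eqP/eqP => [/Normc.eq0_normc//|->]; rewrite nm0. Qed.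

Lemma nm_gt0 z : (0 < nm z) = (z != 0).
Proof. by rewrite lt_def nm_eq0 nm_ge0 andbT. Qed.

Lemma nm_Rl (x : R) : nm x%:C = `|x|.
Proof. by rewrite /Normc.normc /= expr0n addr0 sqrtr_sqr. Qed.

Lemma nm_nat k : nm k%:R = k%:R.
Proof. by rewrite -(@rmorph_nat _ _ (real_complex R)) nm_Rl normr_nat. Qed.

Lemma nm1 : nm 1 = 1.
Proof. exact: Normc.normc1. Qed.

Lemma nmRe z : `|complex.Re z| <= nm z.
Proof.
case: z => a b /=; rewrite -sqrtr_sqr ler_sqrt ?lerDl ?sqr_ge0//.
by rewrite addr_ge0 ?sqr_ge0.
Qed.

Lemma nmIm z : `|complex.Im z| <= nm z.
Proof.
case: z => a b /=; rewrite -sqrtr_sqr ler_sqrt ?lerDr ?sqr_ge0//.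
by rewrite addr_ge0 ?sqr_ge0.
Qed.

Lemma nmReIm z : nm z <= `|complex.Re z| + `|complex.Im z|.
Proof.
case: z => a b /=.
rewrite -[leRHS]ger0_norm ?addr_ge0// -sqrtr_sqr ler_sqrt ?sqr_ge0//.
by rewrite sqrrD !real_normK ?num_real// lerD2r lerDl mulrn_wge0// mulr_ge0.
Qed.

Lemma nm_sqr z : nm z ^+ 2 = complex.Re z ^+ 2 + complex.Im z ^+ 2.
Proof. by case: z => a b; rewrite /= sqr_sqrtr// addr_ge0 ?sqr_ge0. Qed.

(** This replaces passages to the limit: two quantities are proved equal by bounding their distance
    by [A / 2 ^+ k] for every [k]. *)
Lemma geometric_squeeze (x y A : R) :
  (forall k, x <= y + A / 2 ^+ k) -> x <= y.
Proof.
move=> h; apply/ler_addgt0Pr => e e0.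
have [A0|A0] := leP A 0.
  apply: le_trans (h 0%N) _; rewrite expr0 divr1 lerD2l; exact: le_trans (ltW e0).
pose N := Num.bound (A / e); have hN : A / e < N%:R.
  by have := archi_boundP (ltW (divr_gt0 A0 e0)).
apply: le_trans (h N) _; rewrite lerD2l ler_pdivrMr ?exprn_gt0//.
rewrite mulrC -ler_pdivrMr//; apply: (le_trans (ltW hN)).
by rewrite -natrX ler_nat ltnW// ltn_expl.
Qed.

Lemma real_geometric_limit (u : nat -> R) (A : R) :
  (forall k, `|u k.+1 - u k| <= A / 2 ^+ k) ->
  exists l, forall k, `|u k - l| <= 2 * A / 2 ^+ k.
Proof.
move=> hu.
have A0 : 0 <= A by have := hu 0%N; rewrite expr0 divr1; apply: le_trans.
(* [c k] bounds the tail after [k]: the [u k - c k] increase, the [u k + c k] decrease, and the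
   limit is the supremum of the former. *)
pose c k := 2 * A / 2 ^+ k.
have cS k : c k = A / 2 ^+ k + c k.+1.
  by rewrite /c exprS invfM; field; rewrite expf_neq0.
have c0 k : 0 <= c k by rewrite divr_ge0 ?exprn_ge0// mulr_ge0.
have up i j : (i <= j)%N -> u i - c i <= u j - c j.
  move=> /subnK <-; elim: (j - i)%N => [//|k IH].
  apply: le_trans IH _; rewrite addSn; have := hu (k + i)%N; have := cS (k + i)%N.
  by rewrite ler_norml; lra.
have dn i j : (i <= j)%N -> u j + c j <= u i + c i.
  move=> /subnK <-; elim: (j - i)%N => [//|k IH].
  apply: le_trans _ IH; rewrite addSn; have := hu (k + i)%N; have := cS (k + i)%N.
  by rewrite ler_norml; lra.
have ud i j : u i - c i <= u j + c j.
  have h1 := up i _ (leq_maxl i j); have h2 := dn j _ (leq_maxr i j).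
  have := c0 (maxn i j); lra.
pose S := [set u i - c i | i in [set: nat]].
have hS : has_sup S.
  by split; [exists (u 0%N - c 0%N); exists 0%N|exists (u 0%N + c 0%N) => _ [i _ <-]].
exists (sup S) => k; rewrite -/(c k) ler_norml; apply/andP; split.
  suff : sup S <= u k + c k by lra.
  by apply: ge_sup; [case: hS|move=> _ [i _ <-]].
suff : u k - c k <= sup S by lra.
by apply: ub_le_sup; [case: hS|exists k].
Qed.

Lemma geometric_limit (u : nat -> C) (A : R) :
  (forall k, nm (u k.+1 - u k) <= A / 2 ^+ k) ->
  exists l, forall k, nm (u k - l) <= 4 * A / 2 ^+ k.
Proof.
move=> hu.
have [|a ha] := @real_geometric_limit (fun k => complex.Re (u k)) A.
  by move=> k; apply: le_trans (hu k); rewrite -raddfB; apply: nmRe.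
have [|b hb] := @real_geometric_limit (fun k => complex.Im (u k)) A.
  by move=> k; apply: le_trans (hu k); rewrite -raddfB; apply: nmIm.
exists (a +i* b) => k; apply: le_trans (nmReIm _) _.
have := lerD (ha k) (hb k); rewrite -mulrDl -mulrDl (_ : 2 + 2 = 4); last by ring.
by case: (u k).
Qed.

(** The Banach fixed point theorem on a closed polydisc; a common bound [d] on the coordinates
    stands for the maximum distance. Ratio 1/2 and a first step of at most [rho / 2] keep the [k]-th
    iterate within [rho - rho / 2 ^+ k] of [x0]. *)
Lemma contraction_fixpoint (m : nat) (Phi : (nat -> C) -> nat -> C)
    (x0 : nat -> C) (rho : R) : 0 < rho ->
  (forall v w d,
     (forall i, (i < m)%N -> nm (v i - x0 i) <= rho) ->
     (forall i, (i < m)%N -> nm (w i - x0 i) <= rho) -> 0 <= d ->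
     (forall i, (i < m)%N -> nm (v i - w i) <= d) ->
     forall i, (i < m)%N -> nm (Phi v i - Phi w i) <= d / 2) ->
  (forall i, (i < m)%N -> nm (Phi x0 i - x0 i) <= rho / 2) ->
  exists2 v, (forall i, (i < m)%N -> nm (v i - x0 i) <= rho) &
             (forall i, (i < m)%N -> Phi v i = v i).
Proof.
move=> rho0 lip base.
pose s k := iter k Phi x0.
have rk k : 0 <= rho / 2 ^+ k by rewrite divr_ge0 ?exprn_ge0 ?ltW.
have hs k : (forall i, (i < m)%N -> nm (s k i - x0 i) <= rho - rho / 2 ^+ k) /\
            (forall i, (i < m)%N -> nm (s k.+1 i - s k i) <= rho / 2 / 2 ^+ k).
  elim: k => [|k [IH1 IH2]].
    split=> i im; first by rewrite subrr nm0 expr0 divr1 subrr.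
    by rewrite expr0 divr1; apply: base.
  have E : rho / 2 ^+ k.+1 = rho / 2 / 2 ^+ k by rewrite exprS invfM mulrA.
  have h1 : forall i, (i < m)%N -> nm (s k.+1 i - x0 i) <= rho - rho / 2 ^+ k.+1.
    move=> i im; apply: le_trans (nm_tri _ (s k i) _) _.
    have := IH1 i im; have := IH2 i im; rewrite E.
    have -> : rho / 2 / 2 ^+ k = rho / 2 ^+ k / 2 by rewrite mulrAC.
    lra.
  split=> // i im; rewrite -[s k.+2]/(Phi (s k.+1)) -[X in _ - X i]/(Phi (s k)).
  rewrite exprSr invfM mulrA; apply: lip => //.
  - by move=> j jm; apply: le_trans (h1 j jm) _; rewrite gerBl.
  - by move=> j jm; apply: le_trans (IH1 j jm) _; rewrite gerBl.
  - by rewrite -E.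
have /choice[l hl] : forall i, exists l, (i < m)%N ->
    forall k, nm (s k i - l) <= 4 * (rho / 2) / 2 ^+ k.
  move=> i; have [im|_] := ltnP i m; last by exists 0.
  by have [|l hl] := @geometric_limit (fun k => s k i) (rho / 2);
    [move=> k; apply: (hs k).2|exists l].
have lball i : (i < m)%N -> nm (l i - x0 i) <= rho.
  move=> im; apply: (@geometric_squeeze _ _ (4 * (rho / 2))) => k.
  apply: le_trans (nm_tri _ (s k i) _) _.
  have := (hs k).1 i im; have := hl i im k; have := rk k; rewrite nmBC; lra.
exists l => // i im; apply/eqP; rewrite -subr_eq0 -nm_eq0 eq_le nm_ge0 andbT.
apply: (@geometric_squeeze _ _ (4 * (rho / 2))) => k; rewrite add0r.
apply: le_trans (nm_tri _ (s k.+1 i) _) _.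
have h1 : nm (Phi l i - s k.+1 i) <= (4 * (rho / 2) / 2 ^+ k) / 2.
  rewrite /s iterS -/(s k); apply: lip => //.
  - by move=> j jm; apply: le_trans ((hs k).1 j jm) _; rewrite gerBl.
  - by rewrite divr_ge0 ?exprn_ge0// mulr_ge0// ltW// divr_gt0.
  - by move=> j jm; rewrite nmBC; apply: hl.
have := hl i im k.+1; rewrite exprSr invfM mulrA; lra.
Qed.

Definition nearp n (x : nat -> C) (P : (nat -> C) -> Prop) :=
  exists2 r : R, 0 < r &
    forall z, (forall i, (i < n)%N -> nm (z i - x i) <= r) -> P z.

(** Used with [d = 0], the bound also says that near [x] the value of [f] depends on the first [n]
    coordinates only. *)
Definition loclip n (x : nat -> C) (f : (nat -> C) -> C) :=
  exists2 r : R, 0 < r & exists2 K : R, 0 <= K & forall z w d,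
    (forall i, (i < n)%N -> nm (z i - x i) <= r) ->
    (forall i, (i < n)%N -> nm (w i - x i) <= r) -> 0 <= d ->
    (forall i, (i < n)%N -> nm (z i - w i) <= d) -> nm (f z - f w) <= K * d.

Section LocalLipschitz.
Variables (n : nat) (x : nat -> C).
Implicit Types f g : (nat -> C) -> C.

Lemma nearp_and (P Q : (nat -> C) -> Prop) :
  nearp n x P -> nearp n x Q -> nearp n x (fun z => P z /\ Q z).
Proof.
move=> [r r0 hr] [s s0 hs]; exists (Num.min r s); first by rewrite lt_min r0.
by move=> z hz; split; [apply: hr|apply: hs] => i /hz; rewrite le_min => /andP[].
Qed.

Lemma nearpW (P Q : (nat -> C) -> Prop) :
  (forall z, P z -> Q z) -> nearp n x P -> nearp n x Q.
Proof. by move=> PQ [r r0 h]; exists r => // z /h/PQ. Qed.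

Lemma nearp_all d (P : nat -> (nat -> C) -> Prop) :
  (forall j, (j < d)%N -> nearp n x (P j)) ->
  nearp n x (fun z => forall j, (j < d)%N -> P j z).
Proof.
elim: d => [|d IH] h; first by exists 1.
have h1 := IH (fun j jd => h j (ltnW jd)).
apply: nearpW (nearp_and h1 (h d (ltnSn d))) => z [a b] j.
by rewrite ltnS leq_eqVlt => /orP[/eqP->|/a].
Qed.

Lemma loclip_cst c : loclip n x (fun=> c).
Proof. by exists 1 => //; exists 0 => // *; rewrite subrr nm0 mul0r. Qed.

Lemma loclip_coord i : (i < n)%N -> loclip n x (fun z => z i).
Proof. by move=> im; exists 1 => //; exists 1 => // z w d _ _ _; rewrite mul1r; apply. Qed.

Lemma loclip_bounded f : loclip n x f ->
  exists2 B : R, 0 <= B & nearp n x (fun z => nm (f z) <= B).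
Proof.
move=> [r r0 [K K0 h]]; exists (nm (f x) + K * r).
  by rewrite addr_ge0 ?nm_ge0// mulr_ge0// ltW.
exists r => // z hz; rewrite -[f z](subrK (f x)) addrC.
apply: le_trans (nmD _ _) _; rewrite lerD2l; apply: h => //; last exact: ltW.
by move=> i _; rewrite subrr nm0 ltW.
Qed.

Lemma loclip_near f e : loclip n x f -> 0 < e -> nearp n x (fun z => nm (f z - f x) <= e).
Proof.
move=> [r r0 [K K0 h]] e0; have K1 : 0 < K + 1 by rewrite ltr_wpDl.
exists (Num.min r (e / (K + 1))); first by rewrite lt_min r0 divr_gt0.
move=> z hz.
apply: le_trans (_ : K * (e / (K + 1)) <= _); last first.
  by rewrite mulrCA ler_piMr// ?ltW// ltr_pdivrMr// mul1r ltrDl.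
apply: h.
- by move=> i /hz; rewrite le_min => /andP[].
- by move=> i _; rewrite subrr nm0 ltW.
- by rewrite divr_ge0// ltW.
- by move=> i /hz; rewrite le_min => /andP[].
Qed.

Lemma loclipD f g : loclip n x f -> loclip n x g -> loclip n x (fun z => f z + g z).
Proof.
move=> [r r0 [K K0 h]] [r' r'0 [K' K'0 h']].
exists (Num.min r r'); first by rewrite lt_min r0.
exists (K + K'); first by rewrite addr_ge0.
move=> z w d hz hw d0 zw; rewrite opprD addrACA mulrDl.
apply: le_trans (nmD _ _) _; apply: lerD; [apply: h|apply: h'] => // i im;
  by [have := hz i im; rewrite le_min => /andP[] | have := hw i im; rewrite le_min => /andP[]].
Qed.

Lemma loclipM f g : loclip n x f -> loclip n x g -> loclip n x (fun z => f z * g z).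
Proof.
move=> lf lg; have [B B0 [s s0 hB]] := loclip_bounded lf.
have [B' B'0 [s' s'0 hB']] := loclip_bounded lg.
move: lf lg => [r r0 [K K0 h]] [r' r'0 [K' K'0 h']].
exists (Num.min (Num.min r r') (Num.min s s')); first by rewrite !lt_min r0 r'0 s0.
exists (K * B' + B * K'); first by rewrite addr_ge0// mulr_ge0.
move=> z w d hz hw d0 zw.
have -> : f z * g z - f w * g w = (f z - f w) * g z + f w * (g z - g w) by ring.
rewrite [leRHS]mulrDl; apply: le_trans (nmD _ _) _; rewrite !nmM; apply: lerD.
  rewrite mulrAC; apply: ler_pM; rewrite ?nm_ge0//.
    apply: h => // i im; by [have := hz i im; rewrite !le_min => /andP[/andP[]]
      | have := hw i im; rewrite !le_min => /andP[/andP[]]].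
  by apply: hB' => i im; have := hz i im; rewrite !le_min => /andP[_ /andP[]].
rewrite -mulrA; apply: ler_pM; rewrite ?nm_ge0//.
  by apply: hB => i im; have := hw i im; rewrite !le_min => /andP[_ /andP[]].
apply: h' => // i im; by [have := hz i im; rewrite !le_min => /andP[/andP[]]
      | have := hw i im; rewrite !le_min => /andP[/andP[]]].
Qed.

Lemma loclipX f k : loclip n x f -> loclip n x (fun z => f z ^+ k).
Proof.
move=> lf; elim: k => [|k IH]; first exact: loclip_cst.
have -> : (fun z => f z ^+ k.+1) = (fun z => f z * f z ^+ k).
  by apply/funext => z; rewrite exprS.
exact: loclipM.
Qed.

Lemma loclip_sum d (F : nat -> (nat -> C) -> C) :
  (forall j, (j < d)%N -> loclip n x (F j)) -> loclip n x (fun z => \sum_(j < d) F j z).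
Proof.
elim: d => [|d IH] h.
  by rewrite (_ : (fun z => _) = fun=> 0); [exact: loclip_cst|apply/funext => z; rewrite big_ord0].
rewrite (_ : (fun z => _) = fun z => \sum_(j < d) F j z + F d z); last first.
  by apply/funext => z; rewrite big_ord_recr.
by apply: loclipD; [apply: IH => j jd; apply: h; apply: ltnW|exact: h].
Qed.

End LocalLipschitz.

Lemma loclip_ext n m x y f : (n <= m)%N -> (forall i, (i < n)%N -> x i = y i) ->
  loclip n x f -> loclip m y f.
Proof.
move=> nm' xy [r r0 [K K0 h]]; exists r => //; exists K => // z w d hz hw d0 zw.
by apply: h => // i im; rewrite ?xy// ?hz ?hw ?zw ?(leq_trans im).
Qed.

Lemma evi_loclip n x m (u : (nat -> C) -> nat -> C) (p : itpoly _ m) :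
  (forall i, (i < m)%N -> loclip n x (fun z => u z i)) ->
  loclip n x (fun z => evi (u z) m p).
Proof.
elim: m p => [|m IH] p hu; first exact: loclip_cst.
rewrite (_ : (fun z => _) = fun z => \sum_(i < size (p : {poly itpoly _ m}))
   evi (u z) m (p : {poly itpoly _ m})`_i * u z m ^+ i); last first.
  by apply/funext => z; rewrite evi_sum.
apply: (@loclip_sum _ _ _ (fun i z => evi (u z) m (p : {poly itpoly _ m})`_i * u z m ^+ i)).
move=> i _; apply: loclipM; last exact/loclipX/hu.
by apply: IH => k km; apply: hu; apply: ltnW.
Qed.

(* Newton iteration with frozen slope: the difference quotient of the
   polynomial in its variable is locally Lipschitz in all arguments jointly. *)
Lemma implicit_root n x d (P : (nat -> C) -> {poly C}) (t0 : C) :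
  (forall z, (size (P z) <= d)%N) ->
  (forall j, loclip n x (fun z => (P z)`_j)) ->
  (P x).[t0] = 0 -> (P x)^`().[t0] != 0 ->
  exists2 theta : (nat -> C) -> C, loclip n x theta &
    nearp n x (fun z => (P z).[theta z] = 0).
Proof.
move=> szP lipP Pt0 a0; set a := (P x)^`().[t0] in a0.
(* Entries [n] and [n.+1] of an extended point hold the two arguments of the difference quotient
   [D]; [y] is the base point, and [V] below assembles such points. *)
pose y i := if (i < n)%N then x i else t0.
have lipy f : loclip n x f -> loclip n.+2 y f.
  by apply: loclip_ext; [rewrite -addn2 leq_addr|move=> i im; rewrite /y im].
have yn : y n = t0 by rewrite /y ltnn.
have ySn : y n.+1 = t0 by rewrite /y ltnNge leqnSn.
pose D (v : nat -> C) := \sum_(j < d) (P v)`_j *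
   \sum_(i < j) v n ^+ (j.-1 - i) * v n.+1 ^+ i.
pose M (v : nat -> C) := \sum_(j < d) (P v)`_j * v n ^+ j.
have lipD : loclip n.+2 y D.
  apply: (@loclip_sum _ _ _ (fun j v => (P v)`_j *
    \sum_(i < j) v n ^+ (j.-1 - i) * v n.+1 ^+ i)) => j _.
  apply: loclipM; first exact: lipy.
  apply: (@loclip_sum _ _ _ (fun i v => v n ^+ (j.-1 - i) * v n.+1 ^+ i)) => i _.
  by apply: loclipM; apply/loclipX/loclip_coord.
have lipM : loclip n.+2 y M.
  apply: (@loclip_sum _ _ _ (fun j v => (P v)`_j * v n ^+ j)) => j _.
  by apply: loclipM; [exact: lipy|apply/loclipX/loclip_coord].
(* By the Lipschitz bounds with [d = 0], the coefficients ignore the entries from [n] on, hence also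
   the two arguments stored there. *)
have dep : nearp n x (fun z => forall w, (forall i, (i < n)%N -> w i = z i) -> P w = P z).
  have := @nearp_all n x d (fun j z => forall w, (forall i, (i < n)%N -> w i = z i) ->
    (P w)`_j = (P z)`_j).
  case=> [j jd|r r0 h].
    have [r r0 [K K0 h]] := lipP j; exists r => // z hz w wz.
    apply/eqP; rewrite -subr_eq0 -nm_eq0 eq_le nm_ge0 andbT -(mulr0 K).
    by apply: h => // i im; rewrite wz ?hz// subrr nm0.
  exists r => // z hz w wz; apply/polyP => j.
  have [jd|dj] := ltnP j d; first exact: h.
  by rewrite !nth_default// (leq_trans _ dj).
pose V (z : nat -> C) t s i := if (i < n)%N then z i else if i == n then t else s.
have Vn z t s : V z t s n = t by rewrite /V ltnn eqxx.
have VSn z t s : V z t s n.+1 = s by rewrite /V ltnNge leqnSn /= gtn_eqF.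
have Vlt z t s i : (i < n)%N -> V z t s i = z i by rewrite /V => ->.
have [r1 r10 h1] := dep.
have xball i : (i < n)%N -> nm (x i - x i) <= r1 by rewrite subrr nm0 ltW.
have PV z t s : (forall i, (i < n)%N -> nm (z i - x i) <= r1) -> P (V z t s) = P z.
  by move=> hz; apply: h1 => // i im; rewrite Vlt.
have Py : P y = P x by apply: h1 => // i im; rewrite /y im.
have Da : D y = a.
  rewrite /D Py /a (horner_coef_wide _ (leq_trans (leq_trans (size_poly _ _) (leq_pred _)) (szP x))).
  have -> : \sum_(i < d) (P x)^`()`_i * t0 ^+ i = \sum_(i < d.+1) (P x)`_i * (t0 ^+ i.-1 *+ i).
    rewrite big_ord_recl mulr0n mulr0 add0r; apply: eq_bigr => i _.
    by rewrite coef_deriv /= mulrnAl mulrnAr.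
  rewrite big_ord_recr /= [(P x)`_d]nth_default// mul0r addr0; apply: eq_bigr => j _.
  congr (_ * _); rewrite yn ySn.
  transitivity (\sum_(i < j) t0 ^+ j.-1); last by rewrite sumr_const card_ord.
  apply: eq_bigr => i _; rewrite -exprD subnK//.
  by rewrite -ltnS prednK ?(leq_ltn_trans _ (ltn_ord i)).
have MP z t s : (forall i, (i < n)%N -> nm (z i - x i) <= r1) -> M (V z t s) = (P z).[t].
  by move=> hz; rewrite /M PV// Vn -horner_coef_wide.
have MD z t s : (forall i, (i < n)%N -> nm (z i - x i) <= r1) ->
    (P z).[t] - (P z).[s] = (t - s) * D (V z t s).
  move=> hz; rewrite !(@horner_coef_wide _ d)// -sumrB mulr_sumr; apply: eq_bigr => j _.
  by rewrite -mulrBr subrXX PV// Vn VSn mulrCA.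
have na : 0 < nm a by rewrite nm_gt0.
have a2 : 0 < nm a / 2 by rewrite divr_gt0.
have [r2 r20 h2] := loclip_near lipD a2.
move: lipM => [r3 r30 [K K0 h3]].
pose r := Num.min r1 (Num.min r2 r3).
have r0 : 0 < r by rewrite !lt_min r10 r20.
have [rr1 rr2 rr3] : [/\ r <= r1, r <= r2 & r <= r3].
  by rewrite /r !ge_min !lexx !orbT.
(* The ball for [z] is shrunk until the first Newton step from [t0], of length at most
   [K * rho / nm a], is at most [r / 2]. *)
pose rho := Num.min r (r / 2 * nm a / (K + 1)).
have K1 : 0 < K + 1 by rewrite ltr_wpDl.
have rho0 : 0 < rho by rewrite lt_min r0 /= !mulr_gt0// invr_gt0.
have rhor : rho <= r by rewrite ge_min lexx.
have Krho : K * rho <= r / 2 * nm a.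
  apply: le_trans (_ : K * (r / 2 * nm a / (K + 1)) <= _).
    by rewrite ler_wpM2l// ge_min lexx orbT.
  rewrite mulrCA ler_piMr//; last by rewrite ler_pdivrMr// mul1r lerDl.
  by rewrite !mulr_ge0 ?nm_ge0// ltW.
have Vball z t s : (forall i, (i < n)%N -> nm (z i - x i) <= rho) ->
    nm (t - t0) <= r -> nm (s - t0) <= r ->
    forall i, (i < n.+2)%N -> nm (V z t s i - y i) <= r.
  move=> hz ht hs i _; rewrite /V /y; case: ifP => im; first exact: le_trans (hz i im) rhor.
  by case: ifP.
have Dlow z t s : (forall i, (i < n)%N -> nm (z i - x i) <= rho) ->
    nm (t - t0) <= r -> nm (s - t0) <= r -> nm (D (V z t s) - a) <= nm a / 2.
  move=> hz ht hs; rewrite -[X in _ - X]Da; apply: h2 => i im.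
  by apply: le_trans rr2; apply: Vball.
have Mlip z w t : (forall i, (i < n)%N -> nm (z i - x i) <= rho) ->
    (forall i, (i < n)%N -> nm (w i - x i) <= rho) -> nm (t - t0) <= r ->
    forall e, 0 <= e -> (forall i, (i < n)%N -> nm (z i - w i) <= e) ->
    nm ((P z).[t] - (P w).[t]) <= K * e.
  move=> hz hw ht e e0 zw.
  rewrite -(MP z t t) -?(MP w t t); try by move=> i im; apply: le_trans rr1; apply: le_trans rhor; auto.
  apply: h3 => //; try by move=> i im; apply: le_trans rr3; apply: Vball.
  move=> i im; rewrite /V; case: ifP => im'; first exact: zw.
  by rewrite subrr nm0.
have ball1 z : (forall i, (i < n)%N -> nm (z i - x i) <= rho) ->
    forall i, (i < n)%N -> nm (z i - x i) <= r1.
  by move=> hz i im; apply: le_trans rr1; apply: le_trans rhor; apply: hz.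
have ex z : exists t, (forall i, (i < n)%N -> nm (z i - x i) <= rho) ->
    nm (t - t0) <= r /\ (P z).[t] = 0.
  have [hz|nz] := pselect (forall i, (i < n)%N -> nm (z i - x i) <= rho); last by exists 0.
  pose Phi (v : nat -> C) (i : nat) := v 0%N - (P z).[v 0%N] / a.
  have [||v hv fv] := @contraction_fixpoint 1 Phi (fun=> t0) r r0.
  - move=> v w e hv hw e0 vw i _; rewrite /Phi.
    have -> : v 0%N - (P z).[v 0%N] / a - (w 0%N - (P z).[w 0%N] / a) =
        (v 0%N - w 0%N) * (- (D (V z (v 0%N) (w 0%N)) - a) / a).
      have := MD z (v 0%N) (w 0%N) (ball1 z hz) => E.
      have -> : v 0%N - (P z).[v 0%N] / a - (w 0%N - (P z).[w 0%N] / a) =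
        (v 0%N - w 0%N) - ((P z).[v 0%N] - (P z).[w 0%N]) / a by ring.
      by rewrite E; field.
    rewrite nmM nmM nmN nmV; apply: ler_pM; rewrite ?mulr_ge0 ?nm_ge0 ?invr_ge0 ?nm_ge0//.
      exact: vw.
    rewrite ler_pdivrMr// mulrC; apply: Dlow => //; [exact: hv|exact: hw].
  - move=> i _; rewrite /Phi addrAC subrr sub0r nmN nmM nmV ler_pdivrMr//.
    rewrite -[(P z).[t0]]subr0 -Pt0; apply: le_trans Krho; apply: Mlip => //.
    + by move=> k _; rewrite subrr nm0 ltW.
    + by rewrite subrr nm0 ltW.
    + exact: ltW.
  exists (v 0%N) => _; split; first exact: hv.
  have /eqP := fv 0%N isT; rewrite /Phi -subr_eq0 addrAC subrr sub0r oppr_eq0 mulf_eq0.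
  by rewrite invr_eq0 (negbTE a0) orbF => /eqP.
have [theta htheta] := choice ex.
exists theta; last by exists rho => // z /htheta[].
exists rho => //; exists (K / (nm a / 2)); first by rewrite divr_ge0// ltW.
move=> z w e hz hw e0 zw.
have [tz Pz] := htheta z hz; have [tw Pw] := htheta w hw.
rewrite mulrAC ler_pdivlMr//.
(* Since [D] stays away from 0, the displacement of the root is controlled by that of the polynomial
   at a fixed argument. *)
have lowD : nm a / 2 <= nm (D (V z (theta z) (theta w))).
  have := nm_triB a (D (V z (theta z) (theta w))); rewrite nmBC.
  have := Dlow z _ _ hz tz tw; lra.
apply: le_trans (_ : nm (theta z - theta w) * nm (D (V z (theta z) (theta w))) <= _).
  by rewrite ler_wpM2l ?nm_ge0.
rewrite -nmM -MD ?Pz; last exact: ball1.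
rewrite sub0r nmN -[(P z).[theta w]]subr0 -Pw; exact: Mlip.
Qed.

End Modulus.

(** * Vanishing ideals of sets of points *)

Section VanishingPolynomials.
Variable K : idomainType.

Definition vanishes (S : set (nat -> K)) m (p : itpoly K m) :=
  forall s, S s -> evi s m p = 0.

(** Irreducibility in the form of primality of the vanishing ideal; properness is obtained
    separately, from a polynomial that does not vanish on [S]. *)
Definition irreducible_set m (S : set (nat -> K)) :=
  forall p q : itpoly K m, vanishes S (p * q) -> vanishes S p \/ vanishes S q.

Lemma evi_upd (u : nat -> K) t m (p : itpoly K m.+1) :
  evi (fun i => if i == m then t else u i) m.+1 p = (map_poly (evi u m) p).[t].
Proof.
rewrite eviS eqxx; congr (_.[_]); apply: eq_map_poly => c; apply: eq_evi => i im.
by rewrite ltn_eqF.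
Qed.

Lemma irreducible_setS m S : irreducible_set m.+1 S -> irreducible_set m S.
Proof.
move=> irr p q h.
have := irr (p%:P : {poly itpoly K m}) (q%:P : {poly itpoly K m}).
case=> [s Ss|H|H].
- by rewrite -polyCM eviC; apply: h.
- by left=> s /H; rewrite eviC.
- by right=> s /H; rewrite eviC.
Qed.

End VanishingPolynomials.

(** * Local sections of a variety near an integer point *)

Section LocalSection.
Variable R : realType.
Local Notation C := R[i].
Local Notation nm := (@Normc.normc R).

(** Induction on the number [k] of coordinates above the base. [F] is the polynomial to be avoided;
    it has to be arbitrary, because eliminating a coordinate replaces it by another one in fewer
    variables. In the base case it is nonzero at some integer point, which becomes [x]. *)
Lemma local_section n k (S : set (nat -> C)) (F : itpoly _ (k + n)) :
  irreducible_set (k + n) S ->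
  (forall f : itpoly _ n, vanishes S f -> f = 0) -> ~ vanishes S F ->
  exists (x : nat -> nat) (u : (nat -> C) -> nat -> C),
    (forall i, (i < k + n)%N -> loclip n (fun i => (x i)%:R) (fun z => u z i)) /\
    nearp n (fun i => (x i)%:R) (fun z =>
      [/\ forall i, (i < n)%N -> u z i = z i,
          forall p : itpoly _ (k + n), vanishes S p -> evi (u z) (k + n) p = 0 &
          evi (u z) (k + n) F != 0]).
Proof.
move=> irr dense; elim: k F irr => [|k IH] F irr nF.
  have : ~ (forall x : nat -> nat, evi (fun i => (x i)%:R) n F = 0).
    by move=> /itpoly_natpoints h; apply: nF => s _; rewrite [F]h rmorph0.
  move=> /existsNP[x /eqP nx]; exists x, id; split; first by move=> i; exact: loclip_coord.
  have lipF : loclip n (fun i => (x i)%:R) (fun z : nat -> C => evi z n F).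
    by apply: (@evi_loclip _ _ _ _ id) => i; exact: loclip_coord.
  have nx2 : 0 < nm (evi (fun i => (x i)%:R) n F) / 2 by rewrite divr_gt0 ?nm_gt0.
  have := loclip_near lipF nx2.
  apply: nearpW => z hz; split=> //; first by move=> p /dense ->; rewrite rmorph0.
  apply: contraTneq hz => ->; rewrite sub0r nmN -ltNge ltr_pdivrMr// ltr_pMr ?nm_gt0//.
  by rewrite ltr1n.
set m := (k + n)%N in IH; set B := (itpoly _ m) in IH.
have irr' : irreducible_set m S by exact: irreducible_setS.
pose J : set {poly B} := [set p | vanishes S (p : itpoly _ m.+1)].
have IC (b : B) : J b%:P <-> vanishes S b.
  by split=> h s /h; rewrite eviC.
have [JD JM J0] : [/\ forall p q, J p -> J q -> J (p + q),
    forall p q, J q -> J (p * q) & J 0].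
  split=> [p q hp hq s Ss|p q hq s Ss|s _]; last by rewrite rmorph0.
    by rewrite rmorphD (hp s Ss) (hq s Ss) addr0.
  by rewrite (rmorphM (evi s m.+1) p q) (hq s Ss) mulr0.
have [s0 Ss0] : exists s, S s.
  by apply: contrapT => h; apply: nF => s Ss; exfalso; apply: h; exists s.
have Jchar a : ~ J a.+1%:R.
  by move=> /(_ s0 Ss0); rewrite rmorph_nat => /eqP; rewrite pnatr_eq0.
have [caseA|[mu [Jmu nlmu smu nmu' [divmu elim]]]] :=
    prime_ideal_elimination JD JM J0 irr Jchar.
  (* The new coordinate is free: it is frozen at a natural number [t] for which [F] specialised at
     [t] remains outside the ideal. *)
  have : ~ (forall t : nat, vanishes S (F : {poly B}).[t%:R]).
    move=> h; apply: nF => s Ss; rewrite eviS.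
    rewrite (@poly_natroots _ (map_poly _ _)) ?horner0// => t.
    by rewrite -(rmorph_nat (evi s m)) horner_map; apply: h.
  move=> /existsNP[t nt]; have [x [u [lu hu]]] := IH _ irr' nt.
  exists x, (fun z i => if i == m then t%:R else u z i); split.
    move=> i; rewrite addSn ltnS leq_eqVlt => /orP[/eqP->|im].
      by rewrite eqxx; exact: loclip_cst.
    by rewrite ltn_eqF//; exact: lu.
  apply: nearpW hu => z [h1 h2 h3]; split.
  - by move=> i im; rewrite ltn_eqF ?h1// (leq_trans im)// leq_addl.
  - move=> p Jp; rewrite evi_upd.
    rewrite (_ : map_poly _ _ = 0) ?horner0//; apply/polyP => i; rewrite coef_map coef0 /=.
    by apply: h2; apply/IC; apply: caseA.
  - by rewrite evi_upd -(rmorph_nat (evi (u z) m)) horner_map.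
have nFmu : ~ J ((F : {poly B}) * mu^`()).
  by move=> /irr[/nF|/nmu'].
have [a [e [ne Je]]] := elim _ nFmu.
have nel : ~ vanishes S (e * lead_coef mu).
  by move=> /irr'[/IC/ne|/IC/nlmu].
have [x [u [lu hu]]] := IH _ irr' nel.
pose P z := map_poly (evi (u z) m) mu.
pose good z := [/\ forall i, (i < n)%N -> u z i = z i,
   forall p : itpoly _ m, vanishes S p -> evi (u z) m p = 0 &
   evi (u z) m (e * lead_coef mu) != 0].
have key z t : good z -> (P z).[t] = 0 ->
    (forall p : {poly B}, J p -> (map_poly (evi (u z) m) p).[t] = 0) /\
    [/\ (map_poly (evi (u z) m) (F : {poly B})).[t] != 0 & (P z)^`().[t] != 0].
  move=> [h1 h2 h3] Pt.
  have [e0 l0] : evi (u z) m e != 0 /\ evi (u z) m (lead_coef mu) != 0.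
    by apply/andP; rewrite -negb_or -mulf_eq0 -rmorphM.
  have Z (p : {poly B}) : J p -> (map_poly (evi (u z) m) p).[t] = 0.
    move=> /divmu[j [q hq]].
    have : map_poly (evi (u z) m) (lead_coef mu ^+ j *: p - q * mu) = 0.
      by apply/polyP => i; rewrite coef_map coef0; apply: h2; apply/IC; apply: hq.
    move=> /(congr1 (horner^~ t)); rewrite rmorphB rmorphM /= map_polyZ /= horner0.
    rewrite hornerD hornerN hornerM hornerZ -/(P z) Pt mulr0 subr0 => /eqP.
    by rewrite mulf_eq0 rmorphXn expf_eq0 (negbTE l0) andbF => /eqP.
  split=> //; apply/andP; rewrite -negb_or -mulf_eq0 /P deriv_map -hornerM -rmorphM /=.
  move: (Z _ Je); rewrite rmorphB rmorphM /= map_polyC hornerD hornerC hornerN hornerM.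
  move=> /eqP; rewrite subr_eq0 => /eqP E; apply: contraNneq e0 => E0.
  by rewrite E E0 mul0r.
pose X i : C := (x i)%:R.
have gX : good X by case: hu => r r0; apply => i _; rewrite subrr nm0 ltW.
have [t0 /eqP rt0] : exists t, root (P X) t.
  apply/closed_rootP; case: gX => _ _; rewrite rmorphM mulf_eq0 => /norP[_ l0].
  by rewrite size_poly_eq// gtn_eqF.
have [z|j|||theta ltheta htheta] := @implicit_root R n X (size mu) P t0.
- exact: size_poly.
- rewrite (_ : (fun z => _) = fun z => evi (u z) m mu`_j); first exact: evi_loclip.
  by apply/funext => z; rewrite coef_map.
- exact: rt0.
- by case: (key _ _ gX rt0) => _ [].
exists x, (fun z i => if i == m then theta z else u z i); split.
  move=> i; rewrite addSn ltnS leq_eqVlt => /orP[/eqP->|im].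
    by rewrite eqxx.
  by rewrite ltn_eqF//; exact: lu.
apply: nearpW (nearp_and hu htheta) => z [gz tz].
have [K1 [K2 K3]] := key z _ gz tz; split.
- by case: gz => h1 _ _ i im; rewrite ltn_eqF ?h1// (leq_trans im)// leq_addl.
- by move=> p Jp; rewrite evi_upd; apply: K1.
- by rewrite evi_upd.
Qed.

End LocalSection.

(** * Strict derivatives and power series *)

Section PowerSeries.
Variable R : realType.
Local Notation C := R[i].
Local Notation nm := (@Normc.normc R).
Implicit Types (b g : nat -> C) (q p l : C) (f : C -> C).

(** Both points move: $f(t) - at$ has an arbitrarily small Lipschitz constant near $t_0$, which is
    exactly what a contraction with frozen slope $a$ needs. *)
Definition strict_derivative f (t0 a : C) := forall e : R, 0 < e ->
  exists2 r : R, 0 < r & forall t s, nm (t - t0) <= r -> nm (s - t0) <= r ->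
    nm (f t - f s - a * (t - s)) <= e * nm (t - s).

Lemma strict_derivative_lip f t0 a : strict_derivative f t0 a ->
  exists2 K : R, 0 < K & exists2 r : R, 0 < r &
    forall t s, nm (t - t0) <= r -> nm (s - t0) <= r ->
    nm (f t - f s) <= K * nm (t - s).
Proof.
move=> h; have [r r0 hr] := h 1 ltr01.
exists (1 + nm a); first by rewrite ltr_pwDl ?nm_ge0.
exists r => // t s ht hs; rewrite -[f t - f s](subrK (a * (t - s))) mulrDl.
by apply: le_trans (nmD _ _) _; rewrite nmM lerD2r; apply: hr.
Qed.

Lemma strict_derivative_cont f t0 a e : strict_derivative f t0 a -> 0 < e ->
  exists2 r : R, 0 < r & forall t, nm (t - t0) <= r -> nm (f t - f t0) <= e.
Proof.
move=> /strict_derivative_lip[K K0 [r r0 h]] e0.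
exists (Num.min r (e / K)); first by rewrite lt_min r0 divr_gt0.
move=> t; rewrite le_min => /andP[h1 h2].
apply: le_trans (h t t0 h1 _) _; first by rewrite subrr nm0 ltW.
by rewrite mulrC -ler_pdivlMr.
Qed.

Lemma strict_derivative_comp f (h' : C -> C) t0 a c :
  strict_derivative f (h' t0) a -> strict_derivative h' t0 c ->
  strict_derivative (f \o h') t0 (a * c).
Proof.
move=> hf hg e e0.
have [K K0 [r r0 hK]] := strict_derivative_lip hg.
have e1 : 0 < e / 2 / K by rewrite !divr_gt0.
have e2 : 0 < e / 2 / (nm a + 1) by rewrite !divr_gt0// ltr_wpDl ?nm_ge0.
have [r1 r10 h1] := hf _ e1; have [r2 r20 h2] := hg _ e2.
have [r3 r30 h3] := strict_derivative_cont hg r10.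
exists (Num.min r (Num.min r2 r3)); first by rewrite !lt_min r0 r20.
move=> t s; rewrite !le_min => /andP[ht1 /andP[ht2 ht3]] /andP[hs1 /andP[hs2 hs3]].
rewrite /=; have -> : f (h' t) - f (h' s) - a * c * (t - s) =
  (f (h' t) - f (h' s) - a * (h' t - h' s)) + a * (h' t - h' s - c * (t - s)) by ring.
apply: le_trans (nmD _ _) _; rewrite nmM.
have -> : e * nm (t - s) = e / 2 / K * (K * nm (t - s)) + e / 2 * nm (t - s).
  by field; rewrite gt_eqF.
apply: lerD.
  apply: le_trans (h1 _ _ (h3 _ ht3) (h3 _ hs3)) _.
  by rewrite ler_pM2l//; apply: hK.
apply: le_trans (_ : nm a * (e / 2 / (nm a + 1) * nm (t - s)) <= _).
  by rewrite ler_wpM2l ?nm_ge0//; apply: h2.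
rewrite mulrA ler_wpM2r ?nm_ge0// mulrCA ler_piMr ?ltW ?divr_gt0//.
by rewrite ltr_pdivrMr ?ltr_wpDl ?nm_ge0// mul1r ltrDl.
Qed.

Lemma strict_derivativeM f (h : C -> C) t0 a c :
  strict_derivative f t0 a -> strict_derivative h t0 c ->
  strict_derivative (fun t => f t * h t) t0 (a * h t0 + f t0 * c).
Proof.
move=> hf hh e e0.
pose B := nm (f t0) + nm (h t0) + nm a + nm c + 1.
have nB : [/\ nm (f t0) + 1 <= B, nm (h t0) + 1 <= B, nm a <= B, nm c <= B & 0 < B].
  have := nm_ge0 (f t0); have := nm_ge0 (h t0); have := nm_ge0 a; have := nm_ge0 c.
  by rewrite /B; split; lra.
case: nB => Bf Bh Ba Bc B0.
have e1 : 0 < e / 4 / B by rewrite !divr_gt0.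
have [r1 r10 h1] := hf _ e1; have [r2 r20 h2] := hh _ e1.
pose e3 := Num.min 1 (e / 4 / B).
have e30 : 0 < e3 by rewrite lt_min ltr01.
have [r3 r30 h3] := strict_derivative_cont hf e30.
have [r4 r40 h4] := strict_derivative_cont hh e30.
exists (Num.min (Num.min r1 r2) (Num.min r3 r4)); first by rewrite !lt_min r10 r20 r30.
move=> t s; rewrite !le_min => /andP[/andP[t1 t2] /andP[t3 t4]].
move=> /andP[/andP[s1 s2] /andP[s3 s4]].
have -> : f t * h t - f s * h s - (a * h t0 + f t0 * c) * (t - s) =
  ((f t - f s - a * (t - s)) * h t + a * (t - s) * (h t - h t0)) +
  (f s * (h t - h s - c * (t - s)) + (f s - f t0) * (c * (t - s))) by ring.
have E : B * (e / 4 / B * nm (t - s)) = e / 4 * nm (t - s) by field; rewrite gt_eqF.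
have b1 : nm (h t) <= B.
  have := h4 t t4; rewrite le_min => /andP[k _]; have := nm_triB (h t) (h t0); lra.
have b2 : nm (f s) <= B.
  have := h3 s s3; rewrite le_min => /andP[k _]; have := nm_triB (f s) (f t0); lra.
have d0 := nm_ge0 (t - s).
have ed0 : 0 <= e / 4 / B * nm (t - s) by rewrite mulr_ge0// ltW.
have q1 : nm ((f t - f s - a * (t - s)) * h t) <= e / 4 * nm (t - s).
  by rewrite nmM mulrC -E; apply: ler_pM; rewrite ?nm_ge0//; apply: h1.
have q2 : nm (f s * (h t - h s - c * (t - s))) <= e / 4 * nm (t - s).
  by rewrite nmM -E; apply: ler_pM; rewrite ?nm_ge0//; apply: h2.
have q3 : nm (a * (t - s) * (h t - h t0)) <= e / 4 * nm (t - s).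
  rewrite -mulrA !nmM -E; apply: ler_pM; rewrite ?mulr_ge0 ?nm_ge0// mulrC ler_wpM2r//.
  by have := h4 t t4; rewrite le_min => /andP[].
have q4 : nm ((f s - f t0) * (c * (t - s))) <= e / 4 * nm (t - s).
  rewrite mulrCA !nmM -E; apply: ler_pM; rewrite ?mulr_ge0 ?nm_ge0// ler_wpM2r//.
  by have := h3 s s3; rewrite le_min => /andP[].
apply: le_trans (nmD _ _) _.
have := nmD ((f t - f s - a * (t - s)) * h t) (a * (t - s) * (h t - h t0)).
have := nmD (f s * (h t - h s - c * (t - s))) ((f s - f t0) * (c * (t - s))).
lra.
Qed.

Lemma strict_derivativeV t0 : t0 != 0 ->
  strict_derivative (fun t => t^-1) t0 (- (t0 ^- 2)).
Proof.
move=> t00 e e0; have n0 : 0 < nm t0 by rewrite nm_gt0.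
(* The first bound keeps [t] away from 0; the second makes the final estimate $6r/|t_0|^3$ at most
   [e]. *)
pose r := Num.min (nm t0 / 2) (e * nm t0 ^+ 3 / 6).
have r0 : 0 < r by rewrite lt_min !divr_gt0// mulr_gt0// exprn_gt0.
have [ra rb] : r <= nm t0 / 2 /\ r <= e * nm t0 ^+ 3 / 6.
  by rewrite /r !ge_min !lexx orbT.
have near t : nm (t - t0) <= r ->
    [/\ t != 0, nm t^-1 <= 2 / nm t0 & nm (t^-1 - t0^-1) <= 2 * r / nm t0 ^+ 2].
  move=> ht; have l : nm t0 / 2 <= nm t.
    by have := nm_triB t0 t; rewrite nmBC; lra.
  have nt : 0 < nm t by apply: lt_le_trans l; rewrite divr_gt0.
  have t1 : t != 0 by rewrite -nm_gt0.
  have v : nm t^-1 <= 2 / nm t0.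
    by rewrite nmV -[leRHS]invf_div lef_pV2 ?posrE ?divr_gt0.
  split=> //; have -> : t^-1 - t0^-1 = t^-1 * t0^-1 * (t0 - t) by field; rewrite t00 t1.
  rewrite !nmM (nmV t0) nmBC.
  have -> : 2 * r / nm t0 ^+ 2 = 2 / nm t0 / nm t0 * r by field; rewrite gt_eqF.
  by rewrite ler_pM ?mulr_ge0 ?nm_ge0 ?invr_ge0 ?nm_ge0// ler_wpM2r ?invr_ge0 ?nm_ge0.
exists r => // t s /near[t1 tv tw] /near[s1 sv sw].
have -> : t^-1 - s^-1 - - (t0 ^- 2) * (t - s) =
   - (t^-1 * (s^-1 - t0^-1) + (t^-1 - t0^-1) * t0^-1) * (t - s).
  by field; rewrite t00 t1 s1.
rewrite nmM nmN ler_wpM2r ?nm_ge0//; apply: le_trans (nmD _ _) _; rewrite !nmM (nmV t0).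
apply: le_trans (_ : 2 / nm t0 * (2 * r / nm t0 ^+ 2) + 2 * r / nm t0 ^+ 2 / nm t0 <= _).
  apply: lerD; first by rewrite ler_pM ?nm_ge0.
  by rewrite ler_wpM2r ?invr_ge0 ?nm_ge0.
have -> : 2 / nm t0 * (2 * r / nm t0 ^+ 2) + 2 * r / nm t0 ^+ 2 / nm t0 = r / (nm t0 ^+ 3 / 6).
  by field; rewrite gt_eqF.
by rewrite ler_pdivrMr ?divr_gt0 ?exprn_gt0// mulrA.
Qed.

Lemma strict_derivative_div f t0 a : t0 != 0 -> strict_derivative f t0 a ->
  strict_derivative (fun t => f t / t) t0 ((a * t0 - f t0) / t0 ^+ 2).
Proof.
move=> t00 hf; have := strict_derivativeM hf (strict_derivativeV t00).
by congr strict_derivative; field.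
Qed.

Definition psum b q n := \sum_(k < n) b k * q ^+ k.

(** The rate $2^{-n}$ is part of the notion of sum, as [geometric_squeeze] requires. *)
Definition ser b q l := exists A : R, forall n, nm (psum b q n - l) <= A / 2 ^+ n.

(* [sv] and [dq] below are projections of opaque existence proofs, so that
   conversion never unfolds them down to complex arithmetic. *)
Lemma sv_sig : {f : (nat -> C) -> C -> C | forall b q,
  f b q = xget 0 [set l | ser b q l]}.
Proof. by exists (fun b q => xget 0 [set l | ser b q l]). Qed.

Definition sv := sval sv_sig.

(* The three radii [1/7 < 3/14 < 3/7] are chosen so that [r / (3/7 - r)] is
   [1/2] at [r = 1/7], and so that coefficients bounded on the disc of radius
   [3/7] give convergence at rate [2^-n] on the disc of radius [3/14]. *)
Definition bnd b (B : R) := forall k, nm (b k) * (3 / 7) ^+ k <= B.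

Lemma psumS b q n : psum b q n.+1 = psum b q n + b n * q ^+ n.
Proof. by rewrite /psum big_ord_recr. Qed.

Lemma ser_uniq b q l l' : ser b q l -> ser b q l' -> l = l'.
Proof.
move=> [A hA] [A' hA']; apply/eqP; rewrite -subr_eq0 -nm_eq0 eq_le nm_ge0 andbT.
apply: (@geometric_squeeze _ _ _ (A + A')) => n; rewrite add0r mulrDl.
by apply: le_trans (nm_tri _ (psum b q n) _) _; rewrite lerD// nmBC.
Qed.

Lemma svE b q l : ser b q l -> sv b q = l.
Proof. by move=> h; rewrite /sv (svalP sv_sig); apply: xget_unique => // l' h'; exact: ser_uniq h' h. Qed.

Lemma bnd_term b B q k x : bnd b B -> nm q <= 3 / 7 * x ->
  nm (b k * q ^+ k) <= B * x ^+ k.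
Proof.
move=> hB hq; rewrite nmM nmX.
apply: le_trans (_ : nm (b k) * (3 / 7 * x) ^+ k <= _).
  by rewrite ler_wpM2l ?nm_ge0// lerXn2r ?nnegrE ?nm_ge0// (le_trans (nm_ge0 q)).
rewrite exprMn mulrA ler_wpM2r//; apply: exprn_ge0.
have := le_trans (nm_ge0 q) hq; lra.
Qed.

Lemma ser_term b q A : (forall k, nm (b k * q ^+ k) <= A / 2 ^+ k) -> ser b q (sv b q).
Proof.
move=> h; have [|l hl] := @geometric_limit _ (psum b q) A.
  by move=> k; rewrite psumS addrC addKr.
have s : ser b q l by exists (4 * A).
by rewrite (svE s).
Qed.

Lemma sv_ser b B q : bnd b B -> nm q <= 3 / 14 -> ser b q (sv b q).
Proof.
move=> hB hq; apply: (@ser_term _ _ B) => k; rewrite -exprVn.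
by apply: bnd_term => //; lra.
Qed.

Lemma ser_tail b q l B x : 0 <= x < 1 -> (forall k, nm (b k * q ^+ k) <= B * x ^+ k) ->
  ser b q l -> forall n, nm (l - psum b q n) <= B * x ^+ n / (1 - x).
Proof.
move=> /andP[x0 x1] hb [A hA] n.
have B0 : 0 <= B by have := hb 0%N; rewrite !expr0 !mulr1; apply: le_trans; exact: nm_ge0.
have x1' : 0 < 1 - x by rewrite subr_gt0.
have part k : nm (psum b q (n + k) - psum b q n) <= B * x ^+ n * (1 - x ^+ k) / (1 - x).
  elim: k => [|k IH]; first by rewrite addn0 subrr nm0 expr0 subrr mulr0 mul0r.
  rewrite addnS psumS addrAC; apply: le_trans (nmD _ _) _.
  apply: le_trans (lerD IH (hb (n + k)%N)) _; rewrite exprD exprS le_eqVlt.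
  by apply/orP; left; apply/eqP; field; rewrite gt_eqF.
apply: (@geometric_squeeze _ _ _ A) => k.
apply: le_trans (nm_tri _ (psum b q (n + k)) _) _; rewrite addrC lerD//.
  apply: le_trans (part k) _; rewrite ler_wpM2r ?invr_ge0 ?(ltW x1')//.
  rewrite ler_piMr ?mulr_ge0 ?exprn_ge0//.
  by rewrite lerBlDr lerDl exprn_ge0.
rewrite nmBC; apply: le_trans (hA _) _.
have A0 : 0 <= A by have := hA 0%N; rewrite expr0 divr1; apply: le_trans; exact: nm_ge0.
by rewrite ler_wpM2l// lef_pV2 ?posrE ?exprn_gt0// ler_weXn2l ?ler1n// leq_addl.
Qed.

Lemma sv_bound b B q : bnd b B -> nm q <= 3 / 14 -> nm (sv b q) <= 2 * B.
Proof.
move=> hB hq; have := @ser_tail b q (sv b q) B (1 / 2) _ _ (sv_ser hB hq) 0.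
rewrite /psum big_ord0 subr0 expr0 mulr1; have -> : B / (1 - 1 / 2) = 2 * B by field.
by apply; [lra|move=> k; apply: bnd_term => //; lra].
Qed.

Lemma dq_sig : {f : (nat -> C) -> C -> nat -> C | forall b p m,
  f b p m = (sv b p - psum b p m.+1) / p ^+ m.+1}.
Proof. by exists (fun b p m => (sv b p - psum b p m.+1) / p ^+ m.+1). Qed.

(** With $P(q) = \sum_k b_k q^k$, these are the coefficients $\sum_{k>m} b_k p^{k-m-1}$ of the
    difference quotient $(P(q)-P(p))/(q-p)$ as a series in $q$; writing them as a tail over a power
    of $p$ is the reason for $p \ne 0$ in what follows. *)
Definition dq := sval dq_sig.

Lemma dq_def b p m : dq b p m = (sv b p - psum b p m.+1) / p ^+ m.+1.
Proof. exact: (svalP dq_sig). Qed.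

Lemma dq_bnd b B p : bnd b B -> p != 0 -> nm p <= 3 / 14 ->
  bnd (dq b p) (B / (3 / 7 - nm p)).
Proof.
move=> hB p0 hp m.
have np : 0 < nm p by rewrite nm_gt0.
have -> : B / (3 / 7 - nm p) =
    B * (nm p / (3 / 7)) ^+ m.+1 / (1 - nm p / (3 / 7)) / nm p ^+ m.+1 * (3 / 7) ^+ m.
  rewrite expr_div_n !exprS; field.
  have n3 : 3 - nm p * 7 != 0 by rewrite gt_eqF//; lra.
  by rewrite n3 !expf_neq0 ?gt_eqF.
rewrite ler_wpM2r ?exprn_ge0 ?divr_ge0// dq_def nmM nmV nmX.
rewrite ler_wpM2r ?invr_ge0 ?exprn_ge0 ?nm_ge0//.
apply: ser_tail; last exact: sv_ser hB hp.
  by rewrite divr_ge0 ?nm_ge0// ltr_pdivrMr; lra.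
by move=> k; apply: bnd_term => //; rewrite mulrC divfK//; lra.
Qed.

(** The coefficients $c_k$ of [dq] satisfy $c_k = b_{k+1} + p c_{k+1}$, so the partial sums
    telescope up to $c_n q^{n+1}$, which decays like $2^{-n}$. *)
Lemma dqE b B p q : bnd b B -> p != 0 -> nm p <= 3 / 14 -> nm q <= 3 / 14 ->
  sv b q - sv b p = (q - p) * sv (dq b p) q.
Proof.
move=> hB p0 hp hq; have hg := dq_bnd hB p0 hp.
have rec k : dq b p k = b k.+1 + p * dq b p k.+1.
  by rewrite !dq_def (psumS b p k.+1) [p ^+ k.+2]exprS; field; rewrite expf_neq0.
have part n : psum b q n.+1 - sv b p =
    (q - p) * psum (dq b p) q n.+1 - dq b p n * q ^+ n.+1.
  elim: n => [|n IH].
    rewrite dq_def /psum !big_ord_recl !big_ord0 dq_def /psum !big_ord_recl !big_ord0 /=.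
    by rewrite !expr0 !expr1; field.
  rewrite psumS addrAC IH [psum (dq b p) q n.+2]psumS (rec n).
  by rewrite [q ^+ n.+2]exprS; ring.
have [A hA] := sv_ser hB hq; have [A' hA'] := sv_ser hg hq.
have A0 : 0 <= A by have := hA 0%N; rewrite expr0 divr1; apply: le_trans; exact: nm_ge0.
have A'0 : 0 <= A' by have := hA' 0%N; rewrite expr0 divr1; apply: le_trans; exact: nm_ge0.
set B' := B / (3 / 7 - nm p) in hg.
apply/eqP; rewrite -subr_eq0 -nm_eq0 eq_le nm_ge0 andbT.
apply: (@geometric_squeeze _ _ _ (A + A' + B')) => n; rewrite add0r.
have -> : sv b q - sv b p - (q - p) * sv (dq b p) q =
   - (psum b q n.+1 - sv b q) + (q - p) * (psum (dq b p) q n.+1 - sv (dq b p) q)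
   - dq b p n * q ^+ n * q.
  rewrite [(q - p) * (_ - _)]mulrBr -[(q - p) * psum _ _ _](subrK (dq b p n * q ^+ n.+1)).
  by rewrite -part exprSr; ring.
have half (x : R) : 0 <= x -> x / 2 ^+ n.+1 <= x / 2 ^+ n.
  move=> x0; rewrite ler_wpM2l// lef_pV2 ?posrE ?exprn_gt0// ler_weXn2l ?ler1n//.
apply: le_trans (nmB _ _) _; rewrite [leRHS]mulrDl [(A + A') * _]mulrDl; apply: lerD.
  apply: le_trans (nmD _ _) _; apply: lerD; rewrite ?nmN.
    exact: le_trans (hA _) (half _ _).
  rewrite nmM -[leRHS]mul1r ler_pM ?nm_ge0//.
    by apply: le_trans (nmB _ _) _; lra.
  exact: le_trans (hA' _) (half _ _).
rewrite nmM -[leRHS]mulr1 ler_pM ?nm_ge0//; last by lra.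
by rewrite -exprVn; apply: bnd_term => //; lra.
Qed.

Lemma bnd_ge0 b B : bnd b B -> 0 <= B.
Proof. by move=> /(_ 0%N); rewrite expr0 mulr1; apply: le_trans; exact: nm_ge0. Qed.

(** For $|p| \le 3/14$ one has $1/(3/7-|p|) \le 14/3 < 5$, a bound uniform in $p$. *)
Lemma dq_bnd5 b B p : bnd b B -> p != 0 -> nm p <= 3 / 14 -> bnd (dq b p) (5 * B).
Proof.
move=> hB p0 hp k; apply: le_trans (dq_bnd hB p0 hp k) _.
rewrite mulrC ler_wpM2r ?(bnd_ge0 hB)// -(invrK 5) lef_pV2 ?posrE ?invr_gt0//; lra.
Qed.

Lemma sv_lip b B p q : bnd b B -> p != 0 -> nm p <= 3 / 14 -> nm q <= 3 / 14 ->
  nm (sv b q - sv b p) <= 10 * B * nm (q - p).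
Proof.
move=> hB p0 hp hq; rewrite (dqE hB)// nmM mulrC ler_wpM2r ?nm_ge0//.
have := sv_bound (dq_bnd5 hB p0 hp) hq; lra.
Qed.

(** Write $P_s$ for the series of [dq b s], so that $P(t)-P(s) = (t-s)P_s(t)$. One passes from
    $P_s(t)$ to $P_q(q)$ through $P_s(q)$, which equals $P_q(s)$ by symmetry of difference
    quotients; each move is Lipschitz with constant [10 * (5 * B)]. *)
Lemma sv_strict_derivative b B q : bnd b B -> q != 0 -> nm q < 3 / 14 ->
  strict_derivative (sv b) q (sv (dq b q) q).
Proof.
move=> hB q0 hq e e0; have B0 := bnd_ge0 hB.
have nq : 0 < nm q by rewrite nm_gt0.
have K0 : 0 < 100 * B + 1 by rewrite ltr_wpDl// mulr_ge0.
pose r := Num.min (3 / 14 - nm q) (Num.min (nm q / 2) (e / (100 * B + 1))).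
have r0 : 0 < r by rewrite !lt_min subr_gt0 hq !divr_gt0.
have [r1 r2 r3] : [/\ r <= 3 / 14 - nm q, r <= nm q / 2 & r <= e / (100 * B + 1)].
  by rewrite /r !ge_min !lexx !orbT.
have near t : nm (t - q) <= r -> t != 0 /\ nm t <= 3 / 14.
  move=> ht; split; last by have := nm_triB t q; lra.
  by rewrite -nm_gt0; have := nm_triB q t; rewrite nmBC; lra.
exists r => // t s ht hs; have [t0 ht'] := near t ht; have [s0 hs'] := near s hs.
have -> : sv b t - sv b s - sv (dq b q) q * (t - s) =
    (t - s) * ((sv (dq b s) t - sv (dq b s) q) + (sv (dq b s) q - sv (dq b q) q)).
  by rewrite (dqE hB)//; ring.
have sym : sv (dq b s) q = sv (dq b q) s.
  have [->//|sq] := eqVneq s q; apply: (@mulfI _ (q - s)).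
    by rewrite subr_eq0 eq_sym.
  by rewrite -(dqE hB s0 hs' (ltW hq)) -[q - s]opprB mulNr -(dqE hB q0 (ltW hq) hs') opprB.
rewrite nmM mulrC ler_wpM2r ?nm_ge0//.
apply: le_trans (_ : 100 * B * r <= _); last first.
  apply: le_trans (_ : (100 * B + 1) * r <= _); first by rewrite ler_wpM2r ?ltW// ltrDl.
  by rewrite mulrC -ler_pdivlMr.
apply: le_trans (nmD _ _) _.
have -> : 100 * B * r = 10 * (5 * B) * r + 10 * (5 * B) * r by ring.
have c0 : 0 <= 10 * (5 * B) by rewrite !mulr_ge0.
rewrite {2}sym; apply: lerD.
  apply: le_trans (sv_lip (dq_bnd5 hB s0 hs') q0 (ltW hq) ht') _.
  by rewrite ler_wpM2l.
apply: le_trans (sv_lip (dq_bnd5 hB q0 (ltW hq)) q0 (ltW hq) hs') _.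
by rewrite ler_wpM2l.
Qed.

Lemma sv_at0 b : sv b 0 = b 0%N.
Proof.
apply: svE; exists (nm (b 0%N)) => -[|n].
  by rewrite /psum big_ord0 sub0r nmN expr0 divr1.
rewrite /psum big_ord_recl big1 ?addr0; last by move=> i _; rewrite expr0n mulr0.
by rewrite /= expr0 mulr1 subrr nm0 divr_ge0 ?nm_ge0 ?exprn_ge0.
Qed.

(** Dividing out the zero $q$ gives $b_0 = -q c_0$ and turns the bound $B$ into $B/(3/7-|q|)$. As
    $|q|/(3/7-|q|) \le 1/2$, the ratio of the constant term to the bound at least doubles, while it
    never exceeds 1: an elementary form of Jensen's inequality. *)
Lemma dq_zero b B q : bnd b B -> b 0%N != 0 -> nm q <= 1 / 7 -> sv b q = 0 ->
  [/\ q != 0, bnd (dq b q) (B / (3 / 7 - nm q)), dq b q 0%N != 0 &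
   forall N, nm (dq b q 0%N) <= B / (3 / 7 - nm q) / 2 ^+ N -> nm (b 0%N) <= B / 2 ^+ N.+1].
Proof.
move=> hB b0 hq Z.
have q0 : q != 0 by apply: contraNneq b0 => q0; rewrite -sv_at0 -{1}q0 Z.
have E : b 0%N = - q * dq b q 0%N.
  by rewrite dq_def Z psumS /psum big_ord0 expr0 expr1; field.
split=> //; first by apply: dq_bnd => //; lra.
  by apply: contraNneq b0 => g0; rewrite E g0 mulr0.
move=> N h; rewrite E nmM nmN; apply: le_trans (ler_wpM2l (nm_ge0 _) h) _.
have d0 : 0 < 3 / 7 - nm q by lra.
have -> : nm q * (B / (3 / 7 - nm q) / 2 ^+ N) = nm q / (3 / 7 - nm q) * (B / 2 ^+ N) by ring.
have -> : B / 2 ^+ N.+1 = 1 / 2 * (B / 2 ^+ N) by rewrite exprS invfM; ring.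
rewrite ler_wpM2r ?divr_ge0 ?(bnd_ge0 hB) ?exprn_ge0// ler_pdivrMr//; lra.
Qed.

Lemma zeros_bound b B (l : seq C) : bnd b B -> uniq l ->
  (forall q, q \in l -> nm q <= 1 / 7 /\ sv b q = 0) -> nm (b 0%N) <= B / 2 ^+ size l.
Proof.
elim: l b B => [|q l IH] b B hB ul hl.
  by have := hB 0%N; rewrite !expr0 mulr1 divr1.
have [b0|b0] := eqVneq (b 0%N) 0.
  by rewrite b0 nm0 divr_ge0 ?(bnd_ge0 hB) ?exprn_ge0.
have [hq Z] := hl q (mem_head _ _).
have [q0 hg _ step] := dq_zero hB b0 hq Z.
move: ul => /= /andP[ql ul]; apply: step; apply: IH => // p pl.
have [hp Zp] : nm p <= 1 / 7 /\ sv b p = 0 by apply: hl; rewrite inE pl orbT.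
split=> //; have /esym/eqP : sv b p - sv b q = (p - q) * sv (dq b q) p.
  by apply: (dqE hB) => //; lra.
rewrite Z Zp subrr mulf_eq0 subr_eq0 => /orP[/eqP pq|/eqP//].
by move: ql; rewrite -pq pl.
Qed.

(** Infinitely many zeros would force $|b_0| \le B/2^n$ for all $n$. *)
Lemma finite_zeros b B : bnd b B -> b 0%N != 0 ->
  exists l : seq C, forall q, nm q <= 1 / 7 -> sv b q = 0 -> q \in l.
Proof.
move=> hB b0; apply: contrapT => H.
have ext (l : seq C) : exists q, [/\ nm q <= 1 / 7, sv b q = 0 & q \notin l].
  apply: contrapT => h; apply: H; exists l => q hq Z; apply: contrapT => ql.
  by apply: h; exists q; split=> //; apply/negP.
have /choice[nx hnx] := ext.
pose L := fix L n := if n is m.+1 then nx (L m) :: L m else [::].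
have hL n : [/\ uniq (L n), size (L n) = n &
    forall q, q \in L n -> nm q <= 1 / 7 /\ sv b q = 0].
  elim: n => [//|n [u sz h]]; have [h1 h2 h3] := hnx (L n); split=> /=.
  - by rewrite h3.
  - by rewrite sz.
  - by move=> q; rewrite inE => /orP[/eqP->//|/h].
have : nm (b 0%N) <= 0.
  apply: (@geometric_squeeze _ _ _ B) => n; rewrite add0r.
  by have [u sz h] := hL n; rewrite -sz; apply: zeros_bound.
by rewrite leNgt nm_gt0 b0.
Qed.

(** The doubling in [dq_zero] also limits how often the same zero can be divided out; the induction
    is on [N] with $B/2^N < |b_0|$. *)
Lemma zero_order b B q : bnd b B -> b 0%N != 0 -> q != 0 -> nm q <= 1 / 7 ->
  exists k g, [/\ exists B', bnd g B', sv g q != 0 &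
    forall p, nm p <= 3 / 14 -> sv b p = (p - q) ^+ k * sv g p].
Proof.
move=> hB b0 q0 hq.
have [N hN] : exists N, B / 2 ^+ N < nm (b 0%N).
  apply: contrapT => h; have : nm (b 0%N) <= 0.
    apply: (@geometric_squeeze _ _ _ B) => n; rewrite add0r leNgt; apply/negP => h'.
    by apply: h; exists n.
  by rewrite leNgt nm_gt0 b0.
elim: N b B hB b0 hN => [|N IH] b B hB b0 hN.
  by have := hB 0%N; rewrite expr0 mulr1 leNgt; move: hN; rewrite expr0 divr1 => ->.
have [Z|nZ] := eqVneq (sv b q) 0; last first.
  by exists 0%N, b; split=> // [|p _]; [exists B|rewrite expr0 mul1r].
have [_ hg g0 step] := dq_zero hB b0 hq Z.
have [|k [g [h1 h2 h3]]] := IH _ _ hg g0.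
  by rewrite ltNge; apply/negP => /step; rewrite leNgt hN.
exists k.+1, g; split=> // p hp; rewrite exprS -mulrA -h3//.
by rewrite -(dqE hB)// ?Z ?subr0//; lra.
Qed.

(** Coefficients of $qP'-P$, the numerator of $(P/q)'$. *)
Definition dcoef b k := (k%:R - 1) * b k.

(** A bound on the radius $6/7$ is assumed because halving the radius absorbs the factor $k-1 \le
    2^k$. The identity is a summation by parts: its boundary term is [n] times a tail, and $|q| \le
    3/14$ is a quarter of $6/7$, so that this term still decays like $2^{-n}$. *)
Lemma dcoef_sv b B q : (forall k, nm (b k) * (6 / 7) ^+ k <= B) ->
  q != 0 -> nm q <= 3 / 14 ->
  bnd (dcoef b) B /\ sv (dcoef b) q = q * sv (dq b q) q - sv b q.
Proof.
move=> hB q0 hq.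
have pow2 k : (k%:R : R) <= 2 ^+ k by rewrite -natrX ler_nat ltnW// ltn_expl.
have hd : bnd (dcoef b) B.
  move=> k; rewrite /dcoef nmM; apply: le_trans (hB k).
  have -> : (6 / 7 : R) ^+ k = 2 ^+ k * (3 / 7) ^+ k.
    by rewrite -exprMn; congr (_ ^+ _); field.
  rewrite mulrA ler_wpM2r ?exprn_ge0// mulrC ler_wpM2l ?nm_ge0//.
  case: k => [|k]; first by rewrite sub0r nmN nm1 expr0.
  by rewrite -natr1 addrK nm_nat (le_trans (pow2 k))// ler_weXn2l// ler1n.
have hb : bnd b B.
  move=> k; apply: le_trans (hB k); rewrite ler_wpM2l ?nm_ge0// lerXn2r ?nnegrE//; lra.
split=> //; have hg := dq_bnd5 hb q0 hq.
have [A hA] := sv_ser hd hq; have [A1 hA1] := sv_ser hg hq; have [A2 hA2] := sv_ser hb hq.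
have part n : q * psum (dq b q) q n =
    n%:R * (sv b q - psum b q n) + psum (dcoef b) q n + psum b q n.
  elim: n => [|n IH]; first by rewrite /psum !big_ord0 !mulr0 mul0r !add0r.
  rewrite psumS mulrDr IH !psumS /dcoef dq_def psumS exprS -natr1; field.
  by rewrite expf_neq0.
have tail n : nm (n%:R * (sv b q - psum b q n)) <= 2 * B / 2 ^+ n.
  rewrite nmM nm_nat.
  apply: le_trans (_ : 2 ^+ n * (B * (1 / 4) ^+ n / (1 - 1 / 4)) <= _).
    apply: ler_pM => //; rewrite ?ler0n ?nm_ge0//.
    apply: ser_tail; [lra| |exact: sv_ser hb hq].
    move=> k; rewrite nmM nmX; apply: le_trans (_ : nm (b k) * (6 / 7 * (1 / 4)) ^+ k <= _).
      by rewrite ler_wpM2l ?nm_ge0// lerXn2r ?nnegrE ?nm_ge0//; lra.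
    by rewrite exprMn mulrA ler_wpM2r ?exprn_ge0.
  have -> : 2 ^+ n * (B * (1 / 4) ^+ n / (1 - 1 / 4)) = 4 / 3 * B * (2 * (1 / 4)) ^+ n.
    by rewrite [in RHS]exprMn; field.
  have -> : 2 * (1 / 4) = 2^-1 :> R by field.
  rewrite exprVn ler_wpM2r ?invr_ge0 ?exprn_ge0//; have := bnd_ge0 hb; lra.
apply/eqP; rewrite -subr_eq0 -nm_eq0 eq_le nm_ge0 andbT.
apply: (@geometric_squeeze _ _ _ (2 * B + A1 + A + A2)) => n; rewrite add0r.
have -> : sv (dcoef b) q - (q * sv (dq b q) q - sv b q) =
   - (n%:R * (sv b q - psum b q n)) + q * (psum (dq b q) q n - sv (dq b q) q)
   - (psum (dcoef b) q n - sv (dcoef b) q) - (psum b q n - sv b q).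
  by rewrite [q * (_ - _)]mulrBr part; ring.
rewrite 3!mulrDl; apply: le_trans (nmB _ _) _; apply: lerD => //.
apply: le_trans (nmB _ _) _; apply: lerD => //.
apply: le_trans (nmD _ _) _; apply: lerD; first by rewrite nmN.
rewrite nmM -[leRHS]mul1r ler_pM ?nm_ge0//; lra.
Qed.

End PowerSeries.

(** * The complex exponential and the nome *)

Section ComplexExponential.
Variable R : realType.
Local Notation C := R[i].
Local Notation nm := (@Normc.normc R).

Lemma real_derive_estimate (f : R -> R) (d e : R) :
  is_derive (0 : R) (1 : R) f d -> 0 < e ->
  exists2 r : R, 0 < r & forall x, `|x| <= r -> `|f x - f 0 - d * x| <= e * `|x|.
Proof.
move=> [df dd] e0.
have := df => /cvgrPdist_le /(_ e e0).
rewrite -/('D_1 f 0) dd => /nbhs_ballP[r /= r0 hr].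
exists (r / 2); first by rewrite divr_gt0.
move=> x hx; have [->|x0] := eqVneq x 0.
  by rewrite subrr mulr0 subrr normr0 mulr0.
have := hr x; rewrite /ball /= sub0r normrN => /(_ (le_lt_trans hx _) x0).
rewrite addr0 => /(_ _)/= h.
have {}h : `|d - x^-1 * (f (x * 1) - f 0)| <= e.
  by have := h; rewrite /GRing.scale /=; apply; rewrite ltr_pdivrMr// ltr_pMr// ltr1n.
rewrite mulr1 in h.
have -> : f x - f 0 - d * x = - (d - x^-1 * (f x - f 0)) * x by field.
by rewrite normrM normrN ler_wpM2r.
Qed.

Lemma cexpD (z w : C) : cexp (z + w) = cexp z * cexp w.
Proof.
case: z w => [a b] [c d]; rewrite /cexp /= expRD cosD sinD.
by apply/eqP; rewrite eq_complex /=; apply/andP; split; apply/eqP; ring.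
Qed.

Lemma nm_cexp (z : C) : nm (cexp z) = expR (complex.Re z).
Proof.
case: z => a b; rewrite /cexp nmM nm_Rl ger0_norm ?expR_ge0//=.
by rewrite cos2Dsin2 sqrtr1 mulr1.
Qed.

(** The complex derivative at 0 is assembled from the real derivatives of [expR], [cos] and [sin] at
    0; [cexpD] will carry it to every other point. *)
Lemma cexp_estimate (e : R) : 0 < e ->
  exists2 r : R, 0 < r & forall w : C, nm w <= r -> nm (cexp w - 1 - w) <= e * nm w.
Proof.
move=> e0; pose n := Num.min 1 (e / 16).
have n0 : 0 < n by rewrite lt_min ltr01 divr_gt0.
have [n1 n2] : n <= 1 /\ n <= e / 16 by rewrite /n !ge_min !lexx orbT.
have dE : is_derive (0 : R) (1 : R) (@expR R) 1 by have := is_derive_expR (0 : R); rewrite expR0.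
have dC : is_derive (0 : R) (1 : R) (@cos R) 0 by have := is_derive_cos (0 : R); rewrite sin0 oppr0.
have dS : is_derive (0 : R) (1 : R) (@sin R) 1 by have := is_derive_sin (0 : R); rewrite cos0.
have [r1 r10 h1] := real_derive_estimate dE n0.
have [r2 r20 h2] := real_derive_estimate dC n0.
have [r3 r30 h3] := real_derive_estimate dS n0.
pose r := Num.min (Num.min r1 r2) (Num.min r3 (Num.min 1 (e / 16))).
exists r; first by rewrite !lt_min r10 r20 r30 ltr01 divr_gt0.
case=> x y hw; set w := x +i* y in hw *.
have hx : `|x| <= nm w := nmRe w. have hy : `|y| <= nm w := nmIm w.
have := hw; rewrite !le_min => /andP[/andP[w1 w2] /andP[w3 /andP[w4 w5]]].
have E := h1 x (le_trans hx w1); have Co := h2 y (le_trans hy w2); have Si := h3 y (le_trans hy w3).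
rewrite expR0 mul1r in E; rewrite cos0 mul0r subr0 in Co; rewrite sin0 subr0 mul1r in Si.
have x0 := normr_ge0 x; have y0 := normr_ge0 y.
have nw := nm_ge0 w.
have E' : `|expR x - 1| <= 2 * nm w.
  rewrite -[expR x - 1](subrK x); apply: le_trans (ler_normD _ _) _.
  have : n * `|x| <= 1 * nm w by apply: ler_pM => //; exact: ltW.
  lra.
have E3 : expR x <= 3.
  have := ler_norm (expR x - 1); lra.
have Ep := expR_ge0 x.
have nyw : n * `|y| <= n * nm w by rewrite ler_wpM2l// ltW.
have nxw : n * `|x| <= n * nm w by rewrite ler_wpM2l// ltW.
have new : n * nm w <= e / 16 * nm w by rewrite ler_wpM2r.
have C1 : `|expR x * (cos y - 1)| <= 3 * (n * nm w).
  by rewrite normrM (ger0_norm Ep); apply: ler_pM => //; apply: le_trans Co _.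
have S1 : `|expR x * (sin y - y)| <= 3 * (n * nm w).
  by rewrite normrM (ger0_norm Ep); apply: ler_pM => //; apply: le_trans Si _.
have S2 : `|(expR x - 1) * y| <= 2 * (e / 16) * nm w.
  rewrite normrM; apply: le_trans (_ : 2 * nm w * nm w <= _); first exact: ler_pM.
  by rewrite ler_wpM2r// ler_wpM2l.
apply: le_trans (nmReIm _) _.
have -> : complex.Re (cexp w - 1 - w) = (expR x - 1 - x) + expR x * (cos y - 1).
  by rewrite /cexp /=; ring.
have -> : complex.Im (cexp w - 1 - w) = expR x * (sin y - y) + (expR x - 1) * y.
  by rewrite /cexp /=; ring.
have := ler_normD (expR x - 1 - x) (expR x * (cos y - 1)).
have := ler_normD (expR x * (sin y - y)) ((expR x - 1) * y).
have : 0 <= e * nm w by rewrite mulr_ge0// ltW.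
lra.
Qed.

Lemma cexp_strict_derivative (z : C) : strict_derivative (@cexp R) z (cexp z).
Proof.
move=> e e0; pose M := nm (cexp z) + 1.
have M0 : 0 < M by rewrite ltr_wpDl ?nm_ge0.
have e1 : 0 < e / 2 / (M * M) by rewrite !divr_gt0// mulr_gt0.
have e2 : 0 < Num.min 1 (e / 4 / M) by rewrite lt_min ltr01 !divr_gt0.
have [r1 r10 h1] := cexp_estimate e1.
have [r2 r20 h2] := cexp_estimate ltr01.
pose r := Num.min (r1 / 2) (Num.min r2 (Num.min 1 (e / 4 / M) / (2 * M))).
have r0 : 0 < r by rewrite !lt_min r20 !divr_gt0// mulr_gt0.
have [ra rb rc] : [/\ r <= r1 / 2, r <= r2 & r <= Num.min 1 (e / 4 / M) / (2 * M)].
  by rewrite /r !ge_min !lexx !orbT.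
exists r => // t s ht hs.
have cs : nm (cexp s - cexp z) <= Num.min 1 (e / 4 / M).
  have -> : cexp s - cexp z = cexp z * ((cexp (s - z) - 1 - (s - z)) + (s - z)).
    by rewrite -[in LHS](subrK z s) cexpD; ring.
  rewrite nmM; apply: le_trans (_ : M * (2 * nm (s - z)) <= _).
    apply: ler_pM; rewrite ?nm_ge0 ?lerDl//; apply: le_trans (nmD _ _) _.
    have := h2 (s - z) (le_trans hs rb); lra.
  apply: le_trans (_ : M * (2 * (Num.min 1 (e / 4 / M) / (2 * M))) <= _).
    by rewrite ler_pM2l// ler_pM2l// (le_trans hs).
  by rewrite le_eqVlt; apply/orP; left; apply/eqP; field; rewrite gt_eqF.
have := cs; rewrite le_min => /andP[cs1 cs2].
have cM : nm (cexp s) <= M by have := nm_triB (cexp s) (cexp z); rewrite /M; lra.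
have ts : nm (t - s) <= r1.
  by have := nm_tri t z s; rewrite (nmBC z s); lra.
have -> : cexp t - cexp s - cexp z * (t - s) =
    cexp s * (cexp (t - s) - 1 - (t - s)) + (cexp s - cexp z) * (t - s).
  by rewrite -[in LHS](subrK s t) cexpD; ring.
apply: le_trans (nmD _ _) _; rewrite (nmM (cexp s)) (nmM (cexp s - _)).
have d0 := nm_ge0 (t - s).
have A1 : nm (cexp s) * nm (cexp (t - s) - 1 - (t - s)) <= e / 2 * nm (t - s).
  apply: le_trans (_ : M * (e / 2 / (M * M) * nm (t - s)) <= _).
    by apply: ler_pM; rewrite ?nm_ge0//; apply: h1.
  rewrite mulrA ler_wpM2r//.
  have -> : M * (e / 2 / (M * M)) = e / 2 / M by field; rewrite gt_eqF.
  by rewrite ler_piMr ?divr_ge0 ?(ltW e0)// invf_le1// lerDr nm_ge0.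
have A2 : nm (cexp s - cexp z) * nm (t - s) <= e / 2 * nm (t - s).
  rewrite ler_wpM2r//; apply: le_trans cs2 _.
  have : e / 4 / M <= e / 4 by rewrite ler_piMr ?divr_ge0 ?(ltW e0)// invf_le1// lerDr nm_ge0.
  have := ltW e0; lra.
have -> : e * nm (t - s) = e / 2 * nm (t - s) + e / 2 * nm (t - s) by field.
exact: lerD.
Qed.

Lemma nome_arg (z : C) : 2 * pi%:C * 'i * z =
  (- (2 * pi * complex.Im z)) +i* (2 * pi * complex.Re z) :> C.
Proof.
case: z => a b; apply/eqP; rewrite eq_complex /=.
by apply/andP; split; apply/eqP; ring.
Qed.

Lemma nm_nome (z : C) : nm (nome z) = expR (- (2 * pi * complex.Im z)).
Proof. by rewrite /nome nm_cexp nome_arg. Qed.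

Lemma nome_neq0 (z : C) : nome z != 0.
Proof. by rewrite -nm_gt0 nm_nome expR_gt0. Qed.

Lemma nome_strict_derivative (z : C) :
  strict_derivative (@nome R) z (nome z * (2 * pi%:C * 'i)).
Proof.
apply: (@strict_derivative_comp _ (@cexp R) (fun z => 2 * pi%:C * 'i * z)).
  exact: cexp_strict_derivative.
move=> e e0; exists 1 => // t s _ _; rewrite -mulrBr subrr nm0.
by rewrite mulr_ge0 ?nm_ge0 ?ltW.
Qed.

Lemma nome_slope_neq0 (z : C) : nome z * (2 * pi%:C * 'i) != 0.
Proof.
rewrite mulf_neq0 ?nome_neq0//; apply: contraTneq (pi_gt0 R) => /(congr1 (@complex.Im R)).
by rewrite /= => h; rewrite -leNgt; lra.
Qed.

Lemma nome_surj (q : C) : q != 0 -> nm q < 1 ->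
  exists2 z, upper_half_plane z & nome z = q.
Proof.
move=> q0 q1; have nq : 0 < nm q by rewrite nm_gt0.
have pi0 := pi_gt0 R.
have [t [ct st]] : exists t, nm q * cos t = complex.Re q /\ nm q * sin t = complex.Im q.
  pose c := complex.Re q / nm q.
  have c1 : -1 <= c <= 1.
    by rewrite -ler_norml normrM normfV (ger0_norm (ltW nq)) ler_pdivrMr// mul1r nmRe.
  have Ec : nm q * c = complex.Re q by rewrite mulrC divfK ?gt_eqF.
  have Es : nm q * sin (acos c) = `|complex.Im q|.
    rewrite sin_acos// -[nm q](ger0_norm (ltW nq)) -sqrtr_sqr -sqrtrM ?sqr_ge0//.
    rewrite -sqrtr_sqr mulrBr mulr1 -exprMn Ec nm_sqr; congr Num.sqrt; ring.
  have [i0|i0] := leP 0 (complex.Im q).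
    by exists (acos c); rewrite acosK// Ec Es ger0_norm.
  by exists (- acos c); rewrite cosN acosK// sinN mulrN Es Ec ltr0_norm// opprK.
have l0 : ln (nm q) < 0 by rewrite ln_lt0// nq.
exists ((t / (2 * pi)) +i* (- ln (nm q) / (2 * pi))).
  by rewrite /upper_half_plane /= divr_gt0 ?mulr_gt0// oppr_gt0.
rewrite /nome nome_arg /cexp /=.
have pi2 : 2 * pi != 0 :> R by rewrite gt_eqF// mulr_gt0.
have cancel (x : R) : 2 * pi * (x / (2 * pi)) = x by rewrite mulrC divfK.
rewrite !cancel opprK.
rewrite lnK//; apply/eqP; rewrite eq_complex /= !mul0r subr0 addr0 ct st.
by rewrite !eqxx.
Qed.

(** The claim is $e^{-\pi} \le 1/7$, which follows from $\pi \ge 2$ and $e^2 \ge 7$. The latter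
    starts from $e^{1/32} \ge 33/32$ and squares six times, rounding down to short fractions on the
    way. *)
Lemma nome_small (z : C) : 1 / 2 <= complex.Im z -> nm (nome z) <= 1 / 7.
Proof.
move=> hz; rewrite nm_nome expRN -[leRHS]invrK lef_pV2 ?posrE ?expR_gt0 ?invr_gt0 ?divr_gt0//.
have -> : (1 / 7 : R)^-1 = 7 by field.
have p2 := pi_ge2 R.
apply: le_trans (_ : expR 2 <= _); last first.
  by rewrite ler_expR; nra.
have sq (x y : R) : 0 <= y -> y <= expR x -> y ^+ 2 <= expR (2 * x).
  move=> y0 yx; rewrite expRM_natl lerXn2r ?nnegrE ?expR_ge0//.
have a0 : (33 / 32 : R) <= expR (1 / 32).
  by apply: le_trans (expR_ge1Dx _); lra.
have a1 : (84 / 79 : R) <= expR (1 / 16).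
  have -> : 1 / 16 = 2 * (1 / 32) :> R by field.
  apply: le_trans (sq _ _ _ a0); lra.
have a2 : (26 / 23 : R) <= expR (1 / 8).
  have -> : 1 / 8 = 2 * (1 / 16) :> R by field.
  apply: le_trans (sq _ _ _ a1); lra.
have a3 : (23 / 18 : R) <= expR (1 / 4).
  have -> : 1 / 4 = 2 * (1 / 8) :> R by field.
  apply: le_trans (sq _ _ _ a2); lra.
have a4 : (31 / 19 : R) <= expR (1 / 2).
  have -> : 1 / 2 = 2 * (1 / 4) :> R by field.
  apply: le_trans (sq _ _ _ a3); lra.
have a5 : (53 / 20 : R) <= expR 1.
  have -> : 1 = 2 * (1 / 2) :> R by field.
  apply: le_trans (sq _ _ _ a4); lra.
have -> : 2 = 2 * 1 :> R by rewrite mulr1.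
by apply: le_trans (sq _ _ _ a5); lra.
Qed.

End ComplexExponential.

(** * Reduction by the modular group and the expansion of $qj$ *)

Section ModularInvariance.
Variable R : realType.
Local Notation C := R[i].
Local Notation nm := (@Normc.normc R).
Variable j : C -> C.
Hypothesis jinv : SL2Z_invariant j.

Lemma j_moebius (a b c d : int) (z : C) : a * d - b * c = 1 -> upper_half_plane z ->
  j ((a%:~R * z + b%:~R) / (c%:~R * z + d%:~R)) = j z.
Proof.
move=> det1 hz; pose g : 'M[int]_2 := \matrix_(i, k)
  if i == 0 then (if k == 0 then a else b) else (if k == 0 then c else d).
rewrite -(jinv (g := g) _ hz); first by rewrite /moebius !mxE.
rewrite (expand_det_row _ 0) !big_ord_recl big_ord0 /cofactor !det_mx11 !mxE /=.
by rewrite !expr0 !expr1 -[RHS]det1; ring.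
Qed.

Lemma j_translate (m : int) (z : C) : upper_half_plane z -> j (z + m%:~R) = j z.
Proof.
move=> hz; rewrite -[RHS](@j_moebius 1 m 0 1)//; last by rewrite mulr0 subr0.
by congr j; rewrite mul0r add0r mul1r divr1.
Qed.

Lemma j_negV (z : C) : upper_half_plane z -> j (- z^-1) = j z.
Proof.
move=> hz; rewrite -[RHS](@j_moebius 0 (-1) 1 0)//; congr j.
by rewrite mul0r add0r addr0 mul1r mulrNz mulN1r.
Qed.

Lemma Im_negV (z : C) : complex.Im (- z^-1) = complex.Im z / nm z ^+ 2.
Proof. by rewrite nm_sqr; case: z => a b /=; rewrite opprK. Qed.

Lemma reduction_strip (z : C) : upper_half_plane z ->
  exists z', [/\ j z' = j z, complex.Im z' = complex.Im z & `|complex.Re z'| <= 1 / 2].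
Proof.
move=> hz; pose m := - Num.floor (complex.Re z + 1 / 2).
exists (z + m%:~R); rewrite j_translate//.
have -> : (m%:~R : C) = (m%:~R : R)%:C by rewrite rmorph_int.
split=> //; first by case: (z) => a b /=; rewrite addr0.
have -> : complex.Re (z + (m%:~R)%:C) = complex.Re z + m%:~R by case: (z).
have /andP[] := floor_itv (complex.Re z + 1 / 2); rewrite /m mulrNz intrD.
by rewrite ler_norml; lra.
Qed.

(* Off the strip part [Im z >= 1/2] one has [|z|^2 <= 1/2], so [z |-> -1/z] at
   least doubles the imaginary part. *)
Lemma reduction (z : C) : upper_half_plane z ->
  exists z', [/\ j z' = j z, 1 / 2 <= complex.Im z' & `|complex.Re z'| <= 1 / 2].
Proof.
move=> hz; have [N hN] : exists N, 1 / 2 <= 2 ^+ N * complex.Im z.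
  apply: contrapT => h; have : complex.Im z <= 0.
    apply: (@geometric_squeeze _ _ _ 1) => k; rewrite add0r ler_pdivlMr ?exprn_gt0// mulrC.
    by have [//|h'] := leP (2 ^+ k * complex.Im z) 1; exfalso; apply: h; exists k; lra.
  by rewrite leNgt; move: hz; rewrite /upper_half_plane /= => ->.
elim: N z hz hN => [|N IH] z hz hN.
  by have [z' [h1 h2 h3]] := reduction_strip hz; exists z'; rewrite h2 -[complex.Im z]mul1r.
have [z1 [h1 h2 h3]] := reduction_strip hz.
have [i1|i1] := leP (1 / 2) (complex.Im z1); first by exists z1.
have I0 : 0 < complex.Im z1 by rewrite h2.
have hz1 : upper_half_plane z1 by [].
have n2 : nm z1 ^+ 2 <= 1 / 2.
  rewrite nm_sqr; have := h3; rewrite ler_norml => /andP[? ?]; nra.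
have n0 : 0 < nm z1 ^+ 2.
  by rewrite exprn_gt0// nm_gt0; apply: contraTneq I0 => ->; rewrite ltxx.
have d2 : 2 * complex.Im z1 <= complex.Im (- z1^-1).
  rewrite Im_negV ler_pdivlMr//; nra.
have hz2 : upper_half_plane (- z1^-1) by rewrite /upper_half_plane /=; lra.
have [|z' [k1 k2 k3]] := IH _ hz2; last by exists z'; rewrite k1 j_negV.
apply: le_trans hN _; rewrite exprSr -h2 -mulrA ler_wpM2l// exprn_ge0//.
Qed.

(** Multiplying by $q$ clears the pole and shifts the coefficients by one. Convergence at a single
    point with nome $6/7$ bounds the terms there; this radius is twice the $3/7$ of [bnd], as
    [dcoef_sv] requires. *)
Lemma j_expansion : has_j_expansion j ->
  exists b B, [/\ b 0%N = 1, forall k, nm (b k) * (6 / 7) ^+ k <= B &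
    forall z, upper_half_plane z -> nm (nome z) <= 3 / 14 ->
      sv b (nome z) = nome z * j z].
Proof.
move=> [a ha]; pose b k := if k is k'.+1 then a k' else 1.
pose S q N := q^-1 + \sum_(0 <= k < N) a k * q ^+ k.
have cv z : upper_half_plane z -> forall e : R, 0 < e ->
    exists N, forall n, (N <= n)%N -> nm (j z - S (nome z) n) <= e.
  move=> hz e e0; have /cvgrPdist_le/(_ e%:C) := ha z hz.
  rewrite ltcR => /(_ e0)[N _ hN]; exists N => n Nn.
  by have := hN n Nn; rewrite /= [X in X <= _]nmE lecR.
have bS q n : q != 0 -> psum b q n.+1 = q * S q n.
  move=> q0; rewrite /psum big_ord_recl /S mulrDr divff// expr0 mulr1 /=.
  rewrite big_mkord mulr_sumr; congr (_ + _); apply: eq_bigr => i _.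
  by rewrite /= exprS mulrCA.
have [B hB] : exists B, forall k, nm (b k) * (6 / 7) ^+ k <= B.
  have [||z hz qz] := @nome_surj R (6 / 7)%:C.
  - by apply/eqP => /(congr1 (@complex.Re R))/= h; lra.
  - by rewrite nm_Rl ger0_norm; lra.
  have [N hN] := cv z hz 1 ltr01.
  pose T k := nm (a k) * (6 / 7) ^+ k.
  have T0 k : 0 <= T k by rewrite mulr_ge0 ?nm_ge0// exprn_ge0.
  have big k : (N <= k)%N -> T k <= 2.
    move=> Nk; have h1 := hN k Nk; have h2 := hN k.+1 (leqW Nk).
    have -> : T k = nm ((j z - S (nome z) k) - (j z - S (nome z) k.+1)).
      rewrite /S big_nat_recr//= qz.
      rewrite (_ : _ - _ = a k * (6 / 7)%:C ^+ k); last by ring.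
      by rewrite nmM nmX nm_Rl ger0_norm.
    have := nmB (j z - S (nome z) k) (j z - S (nome z) k.+1); lra.
  pose Sm := \sum_(k < N) T k.
  have Sm0 : 0 <= Sm by apply: sumr_ge0.
  have all k : T k <= 2 + Sm.
    have [Nk|kN] := leqP N k; first by have := big k Nk; lra.
    apply: le_trans (_ : Sm <= _); last lra.
    by rewrite /Sm (bigD1 (Ordinal kN))//= lerDl sumr_ge0.
  exists (3 + Sm) => -[|k]; first by rewrite expr0 mulr1 nm1; lra.
  have -> : nm (b k.+1) * (6 / 7) ^+ k.+1 = T k * (6 / 7) by rewrite /T /= [_ ^+ k.+1]exprSr; ring.
  by move: (T k) (all k) (T0 k) => t; lra.
exists b, B; split=> // z hz nz.
have q0 := nome_neq0 z.
have hb : bnd b B.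
  move=> k; apply: le_trans (hB k); rewrite ler_wpM2l ?nm_ge0// lerXn2r ?nnegrE//; lra.
have [A hA] := sv_ser hb nz.
apply/eqP; rewrite -subr_eq0 -nm_eq0 eq_le nm_ge0 andbT.
have A0 : 0 <= A by have := hA 0%N; rewrite expr0 divr1; apply: le_trans; exact: nm_ge0.
apply: (@geometric_squeeze _ _ _ (A + 1)) => k; rewrite add0r mulrDl.
have [N hN] := cv z hz (1 / 2 ^+ k) (divr_gt0 ltr01 (exprn_gt0 _ (ltr0Sn _ 1))).
pose n := maxn N k.
apply: le_trans (nm_tri _ (psum b (nome z) n.+1) _) _; apply: lerD.
  rewrite nmBC; apply: le_trans (hA _) _; rewrite ler_wpM2l// lef_pV2 ?posrE ?exprn_gt0//.
  by rewrite ler_weXn2l ?ler1n// leqW// leq_maxr.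
rewrite bS// -mulrBr nmM nmBC -[leRHS]mul1r; apply: ler_pM; rewrite ?nm_ge0//.
  lra.
by apply: hN; rewrite leq_maxl.
Qed.

End ModularInvariance.

(** * Surjectivity and critical values of $j$ *)

Section ModularValues.
Variable R : realType.
Local Notation C := R[i].
Local Notation nm := (@Normc.normc R).
Variables (j : C -> C) (b : nat -> C) (B : R).
Hypothesis jinv : SL2Z_invariant j.
Hypothesis b0 : b 0%N = 1.
Hypothesis hB : forall k, nm (b k) * (6 / 7) ^+ k <= B.
Hypothesis jb : forall z, upper_half_plane z -> nm (nome z) <= 3 / 14 ->
  sv b (nome z) = nome z * j z.

Let hb : bnd b B.
Proof.
move=> k; apply: le_trans (hB k); rewrite ler_wpM2l ?nm_ge0// lerXn2r ?nnegrE//; lra.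
Qed.

Let j_quot z : upper_half_plane z -> nm (nome z) <= 3 / 14 ->
  j z = sv b (nome z) / nome z.
Proof. by move=> hz nz; rewrite jb// mulrC mulKf ?nome_neq0. Qed.

Lemma strict_derivative_ext (f g : C -> C) (t a : C) (r : R) : 0 < r ->
  (forall s, nm (s - t) <= r -> f s = g s) ->
  strict_derivative f t a -> strict_derivative g t a.
Proof.
move=> r0 fg hf e e0; have [r1 r10 h] := hf e e0.
exists (Num.min r r1); first by rewrite lt_min r0.
move=> s s'; rewrite !le_min => /andP[a1 a2] /andP[b1 b2].
by rewrite -!fg//; apply: h.
Qed.

Lemma upper_half_plane_near (z : C) : upper_half_plane z ->
  exists2 r : R, 0 < r & forall t, nm (t - z) <= r -> upper_half_plane t.
Proof.
rewrite /upper_half_plane /= => hz; exists (complex.Im z / 2); first by rewrite divr_gt0.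
move=> t ht; have := le_trans (nmIm _) ht; rewrite raddfB /= ler_norml; lra.
Qed.

Lemma j_strict_derivative (z : C) : upper_half_plane z -> nm (nome z) <= 1 / 7 ->
  strict_derivative j z ((sv (dq b (nome z)) (nome z) * nome z - sv b (nome z))
     / nome z ^+ 2 * (nome z * (2 * pi%:C * 'i))).
Proof.
move=> hz nz; have q0 := nome_neq0 z.
have nz' : nm (nome z) < 3 / 14 by lra.
(* $1/14 = 3/14 - 1/7$: nearby nomes stay in the disc where $j = P/q$. *)
have e0 : 0 < 1 / 14 :> R by rewrite divr_gt0.
have [r1 r10 h1] := strict_derivative_cont (nome_strict_derivative z) e0.
have [r2 r20 h2] := upper_half_plane_near hz.
apply: (@strict_derivative_ext ((fun q => sv b q / q) \o @nome R) _ _ _ (Num.min r1 r2)).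
- by rewrite lt_min r10.
- move=> s; rewrite le_min => /andP[s1 s2]; rewrite /= j_quot//; first exact: h2.
  have := h1 s s1; have := nm_triB (nome s) (nome z); lra.
apply: (strict_derivative_comp _ (nome_strict_derivative z)).
exact: (strict_derivative_div q0 (sv_strict_derivative hb q0 nz')).
Qed.

(** After reduction only $|\mathrm{Re}\,w| \le 1/2 \le \mathrm{Im}\,w$ matters. High up, the pole at
    $q = 0$ makes $|j - c|$ exceed its value at $i$, so a compact rectangle containing $i$
    suffices. *)
Lemma j_attains_min (c : C) : exists2 z, upper_half_plane z /\ nm (nome z) <= 1 / 7 &
  forall w, upper_half_plane w -> nm (j z - c) <= nm (j w - c).
Proof.
pose z1 : C := 0 +i* 1.
pose m1 := nm (j z1 - c).
have m10 : 0 <= m1 := nm_ge0 _.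
have c0 := nm_ge0 c.
pose Q := m1 + nm c + 1.
have Q0 : 0 < Q by rewrite ltr_wpDl// addr_ge0.
have B0 := bnd_ge0 hb.
(* For $\mathrm{Im}\,w \ge K$ one has $|q| \le 1/K$: the summand [10 * B] then yields $|P-1| \le
   1/2$, and [2 * Q] yields $|j| = |P|/|q| \ge Q$. *)
pose K := 2 * Q + 10 * B + 1.
have K1 : 1 <= K by rewrite /K; lra.
have p2 := pi_ge2 R.
have far w : K <= complex.Im w -> m1 < nm (j w - c).
  move=> hw; have q0 := nome_neq0 w.
  have hw1 : upper_half_plane w by rewrite /upper_half_plane /=; lra.
  have nw : nm (nome w) <= 1 / 7 by apply: nome_small; lra.
  have nq : 0 < nm (nome w) by rewrite nm_gt0.
  have nK : nm (nome w) * K <= 1.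
    rewrite nm_nome expRN mulrC ler_pdivrMr ?expR_gt0// mul1r.
    apply: le_trans (expR_ge1Dx _); nra.
  have hs := @ser_tail _ b (nome w) (sv b (nome w)) B (nm (nome w) / (3 / 7)).
  have := hs _ _ (sv_ser hb _) 1%N.
  have -> : psum b (nome w) 1 = 1 by rewrite /psum big_ord1 expr0 mulr1 b0.
  rewrite expr1; set x := nm (nome w) / (3 / 7) => hh.
  have x1 : x <= 1 / 3 by rewrite /x; lra.
  have x0 : 0 <= x by rewrite /x divr_ge0 ?nm_ge0.
  have {}hh : nm (sv b (nome w) - 1) <= B * x / (1 - x).
    apply: hh; [lra| |lra] => k; apply: bnd_term => //.
    by rewrite /x mulrC divfK//; lra.
  have {}hh : nm (sv b (nome w) - 1) <= 1 / 2.
    apply: le_trans hh _; rewrite ler_pdivrMr; last lra.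
    have -> : x = 7 / 3 * nm (nome w) by rewrite /x; field.
    rewrite /K in nK; nra.
  have P2 : 1 / 2 <= nm (sv b (nome w)).
    by have := nm_triB 1 (sv b (nome w)); rewrite nmBC nm1; lra.
  have jw : Q <= nm (j w).
    rewrite j_quot//; last lra.
    rewrite nmM nmV ler_pdivlMr//; rewrite /K in nK; nra.
  have := nm_triB (j w) c; rewrite /Q in jw; lra.
pose A : set (R * R) := `[- (1 / 2), 1 / 2]%classic `*` `[1 / 2, K]%classic.
pose f (p : R * R) := nm (j (p.1 +i* p.2) - c).
have cA : compact A by apply: compact_setX; exact: segment_compact.
have A1 : A (0, 1).
  by split; rewrite /= in_itv /=; apply/andP; split => //; lra.
have fA : {within A, continuous f}.
  apply: continuous_in_subspaceT => p; rewrite inE => -[/= _].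
  rewrite in_itv /= => /andP[p12 _].
  have hp : upper_half_plane (p.1 +i* p.2) by rewrite /upper_half_plane /=; lra.
  have np : nm (nome (p.1 +i* p.2)) <= 1 / 7 by apply: nome_small.
  apply/cvgrPdist_le => e e0.
  have [r r0 hr] := strict_derivative_cont (j_strict_derivative hp np) e0.
  exists (ball p.1 (r / 2), ball p.2 (r / 2)) => /=.
    by split; apply: nbhsx_ballx; rewrite divr_gt0.
  move=> s [/= s1 s2].
  have hs : nm (j (s.1 +i* s.2) - j (p.1 +i* p.2)) <= e.
    apply: hr; apply: le_trans (nmReIm _) _ => /=.
    move: s1 s2; rewrite /ball /= => s1 s2; rewrite distrC (distrC s.2); lra.
  rewrite /f ler_norml; apply/andP; split.
    have := nm_tri (j (s.1 +i* s.2)) (j (p.1 +i* p.2)) c; lra.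
  rewrite nmBC in hs; have := nm_tri (j (p.1 +i* p.2)) (j (s.1 +i* s.2)) c; lra.
have [p] := compact_EVT_min (ex_intro _ _ A1) cA fA.
rewrite inE => -[/= _]; rewrite in_itv /= => /andP[p12 _] minp.
exists (p.1 +i* p.2); first by split; [rewrite /upper_half_plane /=; lra|exact: nome_small].
move=> w hw; have [w' [jw' iw' rw']] := reduction jinv hw; rewrite -jw'.
have min1 : f p <= m1 by apply: (minp (0, 1)); rewrite inE.
have [wK|/far wK] := ltP (complex.Im w') K; last by apply: le_trans (ltW wK).
have := minp (complex.Re w', complex.Im w'); rewrite /f /=.
rewrite (_ : complex.Re w' +i* complex.Im w' = w'); last by case: (w').
apply; rewrite inE; split=> /=; rewrite in_itv /= ?iw' ?(ltW wK)//.
by rewrite -ler_norml.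
Qed.

(** If the minimum is at [z] with $c_0 = j(z)-c \ne 0$, the series $P(q) - j(z)q$, with coefficients
    [b'], vanishes at $q_0$ to a finite order $k$, so that $j - c = c_0 + (q-q_0)^k g(q)/q$ with
    $g(q_0) \ne 0$. A suitable small move of $q$ then lowers the modulus, and [nome_surj] realises
    it in the upper half-plane. *)
Lemma j_surj (c : C) : exists2 z, upper_half_plane z /\ nm (nome z) <= 1 / 7 & j z = c.
Proof.
have [z [hz nz] minz] := j_attains_min c.
exists z => //; apply: contrapT => jc.
set q0 := nome z; have q00 : q0 != 0 := nome_neq0 z.
have nq0 : nm q0 <= 3 / 14 by rewrite /q0; lra.
pose c0 := j z - c; have c00 : c0 != 0 by rewrite subr_eq0; apply/eqP.
pose b' k := b k - (if k == 1%N then j z else 0).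
have nb' : bnd b' (B + nm (j z)).
  move=> k; rewrite /b'; apply: le_trans (_ : (nm (b k) + nm (j z)) * (3 / 7) ^+ k <= _).
    rewrite ler_wpM2r ?exprn_ge0//; apply: le_trans (nmB _ _) _; rewrite lerD2l.
    by case: ifP => // _; rewrite nm0 nm_ge0.
  rewrite mulrDl; apply: lerD; first exact: (hb k).
  by rewrite ler_piMr ?nm_ge0// exprn_ile1//; lra.
have svb' q : nm q <= 3 / 14 -> sv b' q = sv b q - j z * q.
  move=> hq; have [A hA] := sv_ser hb hq.
  apply: svE; exists (A + 2 * nm (j z * q)) => n.
  have -> : psum b' q n - (sv b q - j z * q) =
     (psum b q n - sv b q) + (if (1 < n)%N then 0 else j z * q).
    have -> : psum b' q n = psum b q n - (if (1 < n)%N then j z * q else 0).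
      elim: n => [|n IH]; first by rewrite /psum !big_ord0 subr0.
      rewrite !psumS IH /b'; case: n IH => [|[|n]] _ /=; rewrite ?expr1 ?expr0; ring.
    by case: ifP => _; ring.
  apply: le_trans (nmD _ _) _; rewrite mulrDl lerD//.
  case: ifP => [_|]; first by rewrite nm0 divr_ge0 ?mulr_ge0 ?nm_ge0 ?exprn_ge0.
  have := nm_ge0 (j z * q).
  case: n => [|[|n]]// w0 _; rewrite ?expr0 ?expr1; lra.
have b'0 : b' 0%N != 0 by rewrite /b' /= subr0 b0 oner_neq0.
have [k [g [[B' hg] g0 eqg]]] := zero_order nb' b'0 q00 nz.
have k0 : (0 < k)%N.
  case: k eqg => [|//] /(_ q0 nq0); rewrite expr0 mul1r svb'// jb// mulrC subrr => /esym/eqP.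
  by rewrite (negbTE g0).
have jE w : upper_half_plane w -> nm (nome w) <= 3 / 14 ->
    j w - c = c0 + (nome w - q0) ^+ k * (sv g (nome w) / nome w).
  move=> hw nw; have w0 := nome_neq0 w.
  rewrite mulrA -eqg// svb'// jb//; rewrite /c0; field.
  by [].
(* In the direction [om] the leading term at $q_0 + t\,om$ is $-t^k c_0$. *)
have [om hom] : exists om : C, om ^+ k = - c0 * q0 / sv g q0.
  have /closed_rootP[om] : size ('X^k - (- c0 * q0 / sv g q0)%:P : {poly C}) != 1%N.
    by rewrite size_XnsubC// eqSS gtn_eqF.
  by rewrite /root hornerD hornerN hornerXn hornerC subr_eq0 => /eqP h; exists om.
have omk0 : om ^+ k != 0.
  by rewrite hom; apply: mulf_neq0; [apply: mulf_neq0; rewrite ?oppr_eq0|rewrite invr_eq0].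
have om0 : 0 < nm om.
  by rewrite nm_gt0; apply: contraNneq omk0 => ->; rewrite expr0n gtn_eqF.
have nomk : 0 < nm (om ^+ k) by rewrite nm_gt0.
have nc0 : 0 < nm c0 by rewrite nm_gt0.
have nq : 0 < nm q0 by rewrite nm_gt0.
(* With this tolerance the modulus is at most $(1-t^k)|c_0| + t^k|c_0|/2 < |c_0|$. *)
have eta0 : 0 < nm c0 / 2 / nm (om ^+ k) by rewrite !divr_gt0.
have nq0' : nm q0 < 3 / 14 by rewrite /q0; lra.
have [r r0 hr] := strict_derivative_cont
  (strict_derivative_div q00 (sv_strict_derivative hg q00 nq0')) eta0.
pose t := Num.min 1 (Num.min (r / nm om) (Num.min (nm q0 / 2 / nm om) (1 / 14 / nm om))).
have t0 : 0 < t by rewrite !lt_min ltr01 !divr_gt0.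
have [t1 t2 t3 t4] : [/\ t <= 1, t * nm om <= r, t * nm om <= nm q0 / 2 & t * nm om <= 1 / 14].
  by rewrite -!ler_pdivlMr// /t !ge_min !lexx !orbT.
pose q := q0 + t%:C * om.
have qq : nm (q - q0) = t * nm om by rewrite /q addrC addKr nmM nm_Rl gtr0_norm.
have q1 : q != 0 by rewrite -nm_gt0; have := nm_triB q0 q; rewrite nmBC qq; lra.
have q2 : nm q <= 3 / 14 by have := nm_triB q q0; rewrite qq; move: nz; rewrite -/q0; lra.
have q3 : nm q < 1 by lra.
have [w hw wq] := nome_surj q1 q3.
have := minz w hw; rewrite (jE w hw) ?wq// -/c0 leNgt => /negP; apply.
have tk0 : 0 < t ^+ k by rewrite exprn_gt0.
have tk1 : t ^+ k <= 1 by rewrite exprn_ile1// ltW.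
have -> : c0 + (q - q0) ^+ k * (sv g q / q) =
    (1 - t ^+ k)%:C * c0 + (t ^+ k)%:C * om ^+ k * (sv g q / q - sv g q0 / q0).
  have -> : (q - q0) ^+ k = (t ^+ k)%:C * om ^+ k.
    by rewrite /q addrC addKr exprMn -rmorphXn.
  have hG : om ^+ k * (sv g q0 / q0) = - c0 by rewrite hom; field; rewrite q00 g0.
  rewrite [X in _ = _ + X](_ : _ = (t ^+ k)%:C * om ^+ k * (sv g q / q)
    - (t ^+ k)%:C * (om ^+ k * (sv g q0 / q0))); last by ring.
  by rewrite hG rmorphB rmorph1; ring.
apply: le_lt_trans (nmD _ _) _; rewrite (nmM (1 - t ^+ k)%:C) nm_Rl ger0_norm ?subr_ge0//.
rewrite (nmM ((t ^+ k)%:C * om ^+ k)) (nmM (t ^+ k)%:C) nm_Rl gtr0_norm//.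
have : nm (sv g q / q - sv g q0 / q0) <= nm c0 / 2 / nm (om ^+ k) by apply: hr; rewrite qq.
rewrite ler_pdivlMr// mulrC => h.
have : t ^+ k * (nm (om ^+ k) * nm (sv g q / q - sv g q0 / q0)) <= t ^+ k * (nm c0 / 2).
  by rewrite ler_wpM2l// ltW.
rewrite mulrA; have : 0 < t ^+ k * nm c0 by rewrite mulr_gt0.
by lra.
Qed.

(* Zeros of [j'] in [Im z >= 1/2] are zeros of the power series [q P' - P],
   where [j = P / q]. *)
Lemma noncritical_values : exists E : seq C, forall y, y \notin E ->
  exists z a, [/\ upper_half_plane z, j z = y, a != 0 & strict_derivative j z a].
Proof.
have bd : bnd (dcoef b) B.
  have [||//] := @dcoef_sv R b B (1 / 7)%:C hB.
    by apply/eqP => /(congr1 (@complex.Re R))/= h; lra.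
  by rewrite nm_Rl ger0_norm; lra.
have d0 : dcoef b 0%N != 0 by rewrite /dcoef b0 sub0r mulr1 oppr_eq0 oner_neq0.
have [l hl] := finite_zeros bd d0.
exists [seq sv b q / q | q <- l] => y yE.
have [z [hz nz] jz] := j_surj y; have q0 := nome_neq0 z.
have nz' : nm (nome z) <= 3 / 14 by lra.
exists z, ((sv (dq b (nome z)) (nome z) * nome z - sv b (nome z))
     / nome z ^+ 2 * (nome z * (2 * pi%:C * 'i))); split=> //; last exact: j_strict_derivative.
rewrite mulf_neq0 ?nome_slope_neq0// mulf_neq0 ?invr_eq0 ?expf_neq0//.
apply: contra yE => /eqP D0; rewrite -jz j_quot//; apply: map_f; apply: hl => //.
by have [_ ->] := dcoef_sv hB q0 nz'; rewrite mulrC.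
Qed.

End ModularValues.

(** * Solving $j(z_i) = y_i(z)$ near an integer point *)

Section SolvingEquations.
Variable R : realType.
Local Notation C := R[i].
Local Notation nm := (@Normc.normc R).

Lemma uniform_radius n (P : nat -> R -> Prop) :
  (forall i r s, s <= r -> P i r -> P i s) ->
  (forall i, (i < n)%N -> exists2 r : R, 0 < r & P i r) ->
  exists2 r : R, 0 < r & forall i, (i < n)%N -> P i r.
Proof.
move=> mono; elim: n => [|n IH] h; first by exists 1.
have [r r0 hr] := IH (fun i im => h i (leqW im)).
have [s s0 hs] := h n (ltnSn n).
exists (Num.min r s); first by rewrite lt_min r0.
move=> i; rewrite ltnS leq_eqVlt => /orP[/eqP->|im].
  by apply: mono hs; rewrite ge_min lexx orbT.
by apply: mono (hr i im); rewrite ge_min lexx.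
Qed.

Lemma uniform_lipschitz n m (x : nat -> C) (f : nat -> (nat -> C) -> C) :
  (forall i, (i < m)%N -> loclip n x (f i)) ->
  exists2 r : R, 0 < r & exists2 K : R, 0 <= K & forall l z w d, (l < m)%N ->
    (forall i, (i < n)%N -> nm (z i - x i) <= r) ->
    (forall i, (i < n)%N -> nm (w i - x i) <= r) -> 0 <= d ->
    (forall i, (i < n)%N -> nm (z i - w i) <= d) -> nm (f l z - f l w) <= K * d.
Proof.
elim: m => [|m IH] h; first by exists 1 => //; exists 0.
have [r r0 [K K0 hK]] := IH (fun i im => h i (leqW im)).
have [s s0 [L L0 hL]] := h m (ltnSn m).
exists (Num.min r s); first by rewrite lt_min r0.
exists (K + L); first by rewrite addr_ge0.
move=> l z w d lm hz hw d0 zw; rewrite mulrDl.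
have Kd : 0 <= K * d by rewrite mulr_ge0.
have Ld : 0 <= L * d by rewrite mulr_ge0.
have z1 i (im : (i < n)%N) : nm (z i - x i) <= r /\ nm (z i - x i) <= s.
  by apply/andP; rewrite -le_min; apply: hz.
have w1 i (im : (i < n)%N) : nm (w i - x i) <= r /\ nm (w i - x i) <= s.
  by apply/andP; rewrite -le_min; apply: hw.
move: lm; rewrite ltnS leq_eqVlt => /orP[/eqP->|lm].
  rewrite -[leLHS]add0r lerD//; apply: hL => // i im; [exact: (z1 i im).2|exact: (w1 i im).2].
rewrite -[leLHS]addr0 lerD//; apply: hK => // i im; [exact: (z1 i im).1|exact: (w1 i im).1].
Qed.

(* Newton iteration in the coordinates [t_i] with [z_i = x_i - 1/(t_i + k)]: for
   large [k] the points [z_i] barely move with [t_i], while [j z_i = j t_i]. *)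
Lemma solve_near_integers (j : C -> C) n (x : nat -> nat)
    (y : nat -> (nat -> C) -> C) (Q : (nat -> C) -> Prop) :
  SL2Z_invariant j ->
  (forall i, (i < n)%N -> loclip n (fun k => (x k)%:R) (y i)) ->
  nearp n (fun k => (x k)%:R) Q ->
  (forall i, (i < n)%N -> exists t, [/\ upper_half_plane t, j t = y i (fun k => (x k)%:R) &
     (exists2 a, a != 0 & strict_derivative j t a) \/
     nearp n (fun k => (x k)%:R) (fun z => y i z = y i (fun k => (x k)%:R))]) ->
  exists z, [/\ forall i, (i < n)%N -> upper_half_plane (z i), Q z &
    forall i, (i < n)%N -> j (z i) = y i z].
Proof.
move=> jinv lipy nQ sol; set X := fun k => (x k)%:R in lipy nQ sol.
(* Coordinates with a nonzero slope are iterated. The others have [y i] locally constant; for them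
   [Phi] below freezes $t_i$ at the given preimage. *)
pose newton (t a : C) := a != 0 /\ strict_derivative j t a.
pose still i := nearp n X (fun z => y i z = y i X).
have /choice[ta hta] : forall i, exists ta : C * C, (i < n)%N ->
    [/\ upper_half_plane ta.1, j ta.1 = y i X & newton ta.1 ta.2 \/ still i].
  move=> i; have [im|_] := ltnP i n; last by exists (0, 0).
  have [t [h1 h2 [[a a0 h3]|h3]]] := sol i im.
    by exists (t, a) => _; split=> //; left.
  by exists (t, 0) => _; split=> //; right.
pose t0 i := (ta i).1; pose a i := (ta i).2.
pose f i z := y i z / a i.
have [r r0 [K K0 lipf]] : exists2 r : R, 0 < r & exists2 K : R, 0 <= K & forall l z w d, (l < n)%N ->
    (forall i, (i < n)%N -> nm (z i - X i) <= r) ->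
    (forall i, (i < n)%N -> nm (w i - X i) <= r) -> 0 <= d ->
    (forall i, (i < n)%N -> nm (z i - w i) <= d) -> nm (f l z - f l w) <= K * d.
  by apply: uniform_lipschitz => i im; apply: loclipM; [exact: lipy|exact: loclip_cst].
have [rho rho0 hrho] : exists2 rho : R, 0 < rho & forall i, (i < n)%N ->
    rho <= complex.Im (t0 i) / 2 /\ (newton (t0 i) (a i) -> forall t s,
      nm (t - t0 i) <= rho -> nm (s - t0 i) <= rho ->
      nm (j t - j s - a i * (t - s)) <= nm (a i) / 4 * nm (t - s)).
  apply: (@uniform_radius n (fun i rho => rho <= complex.Im (t0 i) / 2 /\
     (newton (t0 i) (a i) -> forall t s,
      nm (t - t0 i) <= rho -> nm (s - t0 i) <= rho ->
      nm (j t - j s - a i * (t - s)) <= nm (a i) / 4 * nm (t - s)))).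
    move=> i p q qp [h1 h2]; split; first exact: le_trans h1.
    by move=> nw t s ht hs; apply: h2 => //; apply: le_trans qp.
  move=> i im; have [h1 _ _] := hta i im; rewrite /upper_half_plane /= -/(t0 i) in h1.
  have i2 : 0 < complex.Im (t0 i) / 2 by rewrite divr_gt0.
  have [[a0 sd]|nn] := pselect (newton (t0 i) (a i)); last first.
    by exists (complex.Im (t0 i) / 2).
  have a4 : 0 < nm (a i) / 4 by rewrite divr_gt0 ?nm_gt0.
  have [s s0 hs] := sd _ a4.
  exists (Num.min s (complex.Im (t0 i) / 2)); first by rewrite lt_min s0.
  split; first by rewrite ge_min lexx orbT.
  by move=> _ t t'; rewrite !le_min => /andP[? _] /andP[? _]; apply: hs.
have [r1 r10 hr1] : nearp n X (fun z => Q z /\ forall i, (i < n)%N -> still i -> y i z = y i X).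
  apply: nearp_and => //; apply: nearp_all => i im.
  have [h|h] := pselect (still i); last by exists 1.
  by apply: nearpW h => z e _.
pose M := \sum_(i < n) nm (t0 i).
have hM i : (i < n)%N -> nm (t0 i) <= M.
  by move=> im; rewrite /M (bigD1 (Ordinal im))//= lerDl sumr_ge0// => *; exact: nm_ge0.
have M0 : 0 <= M by apply: sumr_ge0 => i _; exact: nm_ge0.
(* Each summand serves one bound: [L^-1] at most 1, [r] and [r1]; [K * L^-1] at most 1/4, which with
   the 1/4 from strict differentiability gives the ratio 1/2; and [K * L^-1] at most [rho / 2] for
   the first step. *)
pose L := 1 + r^-1 + r1^-1 + 4 * K + 2 * K / rho.
have [v1 v2 v3] : [/\ 0 < r^-1, 0 < r1^-1 & 0 <= 2 * K / rho].
  by rewrite !invr_gt0; split=> //; rewrite divr_ge0 ?mulr_ge0// ltW.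
have [L1 Lr Lr1 LK LK2] : [/\ 1 <= L, r^-1 <= L, r1^-1 <= L, 4 * K <= L & 2 * K / rho <= L].
  by rewrite /L; split; lra.
have L0 : 0 < L by lra.
(* Since $|v_i| \le M + \rho$ on the ball, this shift gives $|v_i + k| \ge L$. *)
pose k := Num.bound (M + rho + L).
have hk : M + rho + L < k%:R.
  by apply: archi_boundP; lra.
have LV : 0 < L^-1 by rewrite invr_gt0.
have Lr' : L^-1 <= r by rewrite -[r]invrK lef_pV2 ?posrE.
have Lr1' : L^-1 <= r1 by rewrite -[r1]invrK lef_pV2 ?posrE.
have KL : K * L^-1 <= 1 / 4 by rewrite ler_pdivrMr//; lra.
have KL2 : K * L^-1 <= rho / 2.
  by rewrite ler_pdivrMr//; move: LK2; rewrite ler_pdivrMr// => ?; rewrite mulrC mulrA; lra.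
have LV1 : L^-1 <= 1 by rewrite invf_le1.
pose z (v : nat -> C) i : C := X i - (v i + k%:R)^-1.
pose ball v := forall i, (i < n)%N -> nm (v i - t0 i) <= rho.
have den v i : ball v -> (i < n)%N -> v i + k%:R != 0 /\ nm (v i + k%:R)^-1 <= L^-1.
  move=> hv im.
  have h : L <= nm (v i + k%:R).
    have h1 := nm_triB k%:R (- v i); rewrite nm_nat nmN opprK in h1.
    rewrite [v i + _]addrC; have := nm_triB (v i) (t0 i); have := hv i im; have := hM i im.
    lra.
  have h0 : 0 < nm (v i + k%:R) by exact: lt_le_trans h.
  by split; [rewrite -nm_gt0|rewrite nmV lef_pV2 ?posrE].
have zX v : ball v -> forall i, (i < n)%N -> nm (z v i - X i) <= L^-1.
  by move=> hv i im; rewrite /z addrAC subrr sub0r nmN; case: (den v i hv im).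
have zlip v w d : ball v -> ball w -> (forall i, (i < n)%N -> nm (v i - w i) <= d) ->
    forall i, (i < n)%N -> nm (z v i - z w i) <= d * L^-1.
  move=> hv hw vw i im; have [n1 m1] := den v i hv im; have [n2 m2] := den w i hw im.
  have -> : z v i - z w i = (v i - w i) * ((v i + k%:R)^-1 * (w i + k%:R)^-1).
    by rewrite /z; field; rewrite n1 n2.
  rewrite nmM nmM; apply: ler_pM; rewrite ?mulr_ge0 ?nm_ge0//; first exact: vw.
  rewrite -[leRHS]mul1r; apply: ler_pM; rewrite ?nm_ge0//; exact: le_trans m1 LV1.
pose Phi v i := if `[< newton (t0 i) (a i) >] then
  v i - j (v i) / a i + f i (z v) else t0 i.
have Xball s : 0 < s -> forall i, (i < n)%N -> nm (X i - X i) <= s.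
  by move=> s0 i _; rewrite subrr nm0 ltW.
have [v w d hv hw d0 vw i im|i im|v hv fv] := @contraction_fixpoint R n Phi t0 rho rho0.
- rewrite /Phi; case: asboolP => [nw|_]; last by rewrite subrr nm0 divr_ge0.
  have [a0 _] := nw; have [_ /(_ nw) hj] := hrho i im.
  have -> : v i - j (v i) / a i + f i (z v) - (w i - j (w i) / a i + f i (z w)) =
    - ((j (v i) - j (w i) - a i * (v i - w i)) / a i) + (f i (z v) - f i (z w)) by field.
  apply: le_trans (nmD _ _) _; rewrite nmN nmM nmV.
  have na : 0 < nm (a i) by rewrite nm_gt0.
  have h1 : nm (j (v i) - j (w i) - a i * (v i - w i)) / nm (a i) <= 1 / 4 * d.
    rewrite ler_pdivrMr//; apply: le_trans (hj _ _ (hv i im) (hw i im)) _.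
    have -> : 1 / 4 * d * nm (a i) = nm (a i) / 4 * d by field.
    by rewrite ler_wpM2l ?divr_ge0 ?nm_ge0//; apply: vw.
  have h2 : nm (f i (z v) - f i (z w)) <= K * (d * L^-1).
    apply: lipf => //.
    + by move=> l lm; apply: le_trans (zX v hv l lm) Lr'.
    + by move=> l lm; apply: le_trans (zX w hw l lm) Lr'.
    + by rewrite mulr_ge0// ltW.
    + exact: zlip.
  have : K * (d * L^-1) <= 1 / 4 * d by rewrite mulrCA mulrC ler_wpM2r.
  lra.
- rewrite /Phi; case: asboolP => [nw|_]; last by rewrite subrr nm0 divr_ge0// ltW.
  have [_ jt _] := hta i im; rewrite jt -/(t0 i).
  have -> : t0 i - y i X / a i + f i (z t0) - t0 i = f i (z t0) - f i X by rewrite /f; ring.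
  have bt : ball t0 by move=> l lm; rewrite subrr nm0 ltW.
  apply: le_trans KL2; apply: lipf => //.
  + by move=> l lm; apply: le_trans (zX _ bt l lm) Lr'.
  + exact: Xball.
  + exact: ltW.
  + exact: zX.
have Qz : Q (z v) /\ forall i, (i < n)%N -> still i -> y i (z v) = y i X.
  by apply: hr1 => i im; apply: le_trans (zX v hv i im) Lr1'.
have Hv i : (i < n)%N -> upper_half_plane (v i).
  move=> im; have [h1 _] := hrho i im; have h2 := le_trans (nmIm _) (hv i im).
  by move: h2; rewrite raddfB /= ler_norml /upper_half_plane /=; lra.
exists (z v); split; [move=> i im|exact: Qz.1|move=> i im].
  have [dn _] := den v i hv im.
  have -> : z v i = - (v i + k%:R)^-1 + X i by rewrite addrC.
  rewrite /upper_half_plane /= raddfD /= Im_negV.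
  have -> : complex.Im (X i) = 0.
    by rewrite /X -(@rmorph_nat _ _ (real_complex R)).
  have -> : complex.Im (v i + k%:R) = complex.Im (v i).
    by rewrite -(@rmorph_nat _ _ (real_complex R)) raddfD /= addr0.
  rewrite addr0 divr_gt0 ?exprn_gt0 ?nm_gt0//; exact: Hv.
have [dn _] := den v i hv im.
have -> : j (z v i) = j (v i).
  (* The matrix with rows $(x, xk-1)$ and $(1, k)$ has determinant 1 and sends $t$ to $x -
     1/(t+k)$. *)
  rewrite -(@j_moebius R j jinv (x i) ((x i)%:Z * k%:Z - 1) 1 k _ _ (Hv i im)); last by ring.
  congr j; rewrite /z /X rmorphB rmorphM /= mul1r -!pmulrn; field.
  by rewrite dn.
have := fv i im; rewrite /Phi; case: asboolP => [[a0 _]|nn].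
  move=> /eqP; rewrite -subr_eq0.
  have -> : v i - j (v i) / a i + f i (z v) - v i = (y i (z v) - j (v i)) / a i.
    by rewrite /f; ring.
  by rewrite mulf_eq0 invr_eq0 (negbTE a0) orbF subr_eq0 => /eqP.
move=> <-; have [_ -> [//|st]] := hta i im.
by rewrite Qz.2.
Qed.

End SolvingEquations.

(** * From row vectors to sequences *)

Section VarietiesAsSequences.
Variable R : realType.
Local Notation C := R[i].

Definition row_seq m (x : 'rV[C]_m) (i : nat) : C :=
  if insub i is Some k then x ord0 k else 0.

Definition seq_row m (v : nat -> C) : 'rV[C]_m := \row_i v i.

(** Entries from [m] on are left free, so that all levels of the polynomial tower can be evaluated
    on the same set. *)
Definition seq_set m (V : set 'rV[C]_m) : set (nat -> C) := [set v | V (seq_row m v)].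

Lemma row_seqE m (x : 'rV[C]_m) (i : 'I_m) : row_seq x i = x ord0 i.
Proof. by rewrite /row_seq valK. Qed.

Lemma row_seqK m (x : 'rV[C]_m) : seq_row m (row_seq x) = x.
Proof. by apply/rowP => i; rewrite mxE row_seqE. Qed.

Lemma meval_seq_row m (v : nat -> C) (p : mpoly.mpoly m C) :
  mpoly.meval (fun i => seq_row m v ord0 i) p = mpoly.meval (fun i => v (val i)) p.
Proof. by apply: mpoly.meval_eq => i; rewrite mxE. Qed.

Lemma seq_set_row m (V : set 'rV[C]_m) x : V x -> seq_set V (row_seq x).
Proof. by rewrite /seq_set /= row_seqK. Qed.

(** If $pq$ vanishes on $V$, then $V$ is the union of the closed subsets that $p$ and $q$ cut out of
    it. *)
Lemma irreducible_variety_set m (V : set 'rV[C]_m) :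
  irreducible_variety V -> irreducible_set m (seq_set V).
Proof.
move=> [[W VW] _ irr] p q pq.
have [P hP] := mpoly_of_itpoly p (leqnn m); have [Q hQ] := mpoly_of_itpoly q (leqnn m).
pose cut (T : mpoly.mpoly m C) := zero_locus (W `|` [set T]).
have cutE T x : cut T x <-> V x /\ mpoly.meval (fun i => x ord0 i) T = 0.
  rewrite VW; split=> [h|[h1 h2] t [/h1//|->//]].
  by split=> [t Wt|]; apply: h; [left|right].
have van (T : mpoly.mpoly m C) (t : itpoly _ m) :
    (forall v, mpoly.meval (fun i => v (val i)) T = evi v m t) ->
    V = cut T -> vanishes (seq_set V) t.
  move=> hT VT v; rewrite /seq_set /= => Vv.
  rewrite -hT -meval_seq_row; have : cut T (seq_row m v) by rewrite -VT; exact: Vv.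
  by case/cutE.
have [|||hA|hB] := irr (cut P) (cut Q).
- by exists (W `|` [set P]).
- by exists (W `|` [set Q]).
- apply/seteqP; split=> x; last by case=> /cutE[].
  move=> Vx; have := pq _ (seq_set_row Vx); rewrite rmorphM /= -hP -hQ -!meval_seq_row.
  rewrite row_seqK => /eqP; rewrite mulf_eq0 => /orP[/eqP h|/eqP h]; [left|right];
    exact/cutE.
- by left; apply: van hP hA.
- by right; apply: van hQ hB.
Qed.

Lemma zariski_dense_vanishes n (V : set 'rV[C]_(n + n)) (f : itpoly _ n) :
  zariski_dense (proj_first n @` V) -> vanishes (seq_set V) f -> f = 0.
Proof.
move=> dense vf; have [p hp] := mpoly_of_itpoly f (leqnn n).
have sub : proj_first n @` V `<=` zero_locus [set p].
  move=> _ [x Vx <-] _ ->; rewrite -(vf _ (seq_set_row Vx)) -hp.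
  apply: mpoly.meval_eq => i; rewrite mxE -row_seqE; congr row_seq.
have all : setT `<=` zero_locus [set p].
  by rewrite -dense; apply: smallest_sub => //; exists [set p].
apply: itpoly_natpoints => k.
by rewrite -hp -(meval_seq_row (fun i => (k i)%:R)); exact: (all _ I p).
Qed.

Lemma zariski_denseP n (S : set 'rV[C]_n) :
  (forall f : itpoly _ n, f != 0 -> exists2 v, S (seq_row n v) & evi v n f != 0) ->
  zariski_dense S.
Proof.
move=> h; apply/seteqP; split=> // a _ Z [[P ->] SZ] p Pp; apply: contrapT => pa.
have [f hf] := itpoly_of_mpoly p.
have [|v Sv /eqP] := h f.
  apply: contra_notN pa => /eqP f0; rewrite -[a]row_seqK meval_seq_row -hf f0.
  by rewrite rmorph0.
by rewrite hf -meval_seq_row; apply; apply: (SZ _ Sv).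
Qed.

Lemma vanishes_prod (I : Type) m (S : set (nat -> C)) (r : seq I) (G : I -> itpoly _ m) :
  irreducible_set m S -> S !=set0 -> (forall i, ~ vanishes S (G i)) ->
  ~ vanishes S (\prod_(i <- r) G i).
Proof.
move=> irr [s Ss] nG; elim: r => [|i r IH].
  by rewrite big_nil => /(_ s Ss)/eqP; rewrite rmorph1 oner_eq0.
by rewrite big_cons => /irr[/nG|].
Qed.

Lemma itpoly_lift k n (f : itpoly _ n) :
  exists g : itpoly _ (k + n), forall v : nat -> C, evi v (k + n) g = evi v n f.
Proof.
elim: k => [|k [g hg]]; first by exists f.
by exists (g%:P : {poly itpoly _ (k + n)}) => v; rewrite eviC hg.
Qed.

End VarietiesAsSequences.

(** * Density and infinitude of the solutions *)

Lemma dense_solutions (R : realType) (j : R[i] -> R[i]) n (V : set 'rV[R[i]]_(n + n))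
    (F : itpoly _ n) :
  is_modular_j j -> irreducible_variety V -> zariski_dense (proj_first n @` V) ->
  F != 0 ->
  exists2 v, (proj_first n @` (graph_j j n `&` V)) (seq_row n v) & evi v n F != 0.
Proof.
move=> [_ jinv jexp] irrV dense F0.
have [b [B [b0 hB jb]]] := j_expansion jexp.
have [E hE] := noncritical_values jinv b0 hB jb.
set S := seq_set V.
have irr : irreducible_set (n + n) S := irreducible_variety_set irrV.
have S0 : S !=set0 by case: irrV => _ [x Vx] _; exists (row_seq x); exact: seq_set_row.
have [g hg] := itpoly_lift n F.
have /choice[Y hY] : forall i, exists f : itpoly _ (n + n), (i < n)%N ->
    forall v : nat -> R[i], evi v (n + n) f = v (n + i)%N.
  move=> i; have [im|_] := ltnP i n; last by exists 0.
  have [|f hf] := @itpolyX R[i] (n + n) (n + i); first by rewrite ltn_add2l.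
  by exists f.
have /choice[c hc] : forall e, exists f : itpoly _ (n + n),
    forall v : nat -> R[i], evi v (n + n) f = e by move=> e; exact: itpolyC.
(* A factor $y_i - e$ that vanishes on all of $V$ is replaced by 1, so that primality keeps the
   product [H] outside the vanishing ideal. *)
pose G (ie : nat * R[i]) := if `[< vanishes S (Y ie.1 - c ie.2) >] then 1
  else Y ie.1 - c ie.2.
pose r := [seq (i, e) | i <- iota 0 n, e <- E].
pose H := g * \prod_(ie <- r) G ie.
have nH : ~ vanishes S H.
  move=> /irr[vg|].
    move/eqP: F0; apply; apply: (zariski_dense_vanishes dense) => v Sv.
    by rewrite -hg; apply: vg.
  apply: vanishes_prod => // ie; rewrite /G; case: asboolP => // _.
  by case: S0 => s Ss /(_ s Ss)/eqP; rewrite rmorph1 oner_eq0.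
have [x [u [lu hu]]] := local_section irr (fun f => @zariski_dense_vanishes R n V f dense) nH.
have hX : [/\ forall i, (i < n)%N -> u (fun i => (x i)%:R) i = (x i)%:R,
    forall p : itpoly _ (n + n), vanishes S p -> evi (u (fun i => (x i)%:R)) (n + n) p = 0 &
    evi (u (fun i => (x i)%:R)) (n + n) H != 0].
  by case: hu => s s0; apply => i _; rewrite subrr nm0 ltW.
have [|i im|z [Hz [h1 h2 h3] jz]] := solve_near_integers (y := fun i z => u z (n + i)%N) jinv _ hu.
- by move=> i im; apply: lu; rewrite ltn_add2l.
(* If $y_i(x)$ is exceptional, then nonvanishing of [H] means that its factor had been replaced by
   1: $y_i$ is constant on $V$, and any preimage under $j$ will do. *)
- have [yE|/hE[t [a [ht jt a0 sd]]]] := boolP (u (fun i => (x i)%:R) (n + i)%N \in E); last first.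
    by exists t; split=> //; left; exists a.
  have [t [ht _] jt] := j_surj jinv b0 hB jb (u (fun i => (x i)%:R) (n + i)%N).
  exists t; split=> //; right.
  have [_ _ nHx] := hX.
  have vY : vanishes S (Y i - c (u (fun i => (x i)%:R) (n + i)%N)).
    apply: contrapT => nv; move: nHx; rewrite /H rmorphM rmorph_prod mulf_eq0 negb_or.
    have ir : (i, u (fun i => (x i)%:R) (n + i)%N) \in r.
      by apply: allpairs_f => //; rewrite mem_iota.
    move=> /andP[_]; rewrite prodf_seq_neq0 => /allP/(_ _ ir)/=.
    by rewrite /G /= asboolF// rmorphB /= hY// hc subrr eqxx.
  apply: nearpW hu => z [_ /(_ _ vY) + _]; rewrite rmorphB /= hY// hc => /eqP.
  by rewrite subr_eq0 => /eqP.
have zu : seq_row n z = proj_first n (seq_row (n + n) (u z)).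
  by apply/rowP => i; rewrite !mxE /= h1.
exists z.
  exists (seq_row (n + n) (u z)); last by rewrite zu.
  split.
    exists (seq_row n z); first by move=> i; rewrite mxE; exact: Hz.
    apply/rowP => i; rewrite !mxE; case: splitP => k ik; rewrite !mxE ik; [by rewrite h1|by rewrite jz].
  case: (irrV) => [[W VW] _ _]; rewrite VW => p Wp.
  have [f hf] := itpoly_of_mpoly p.
  rewrite meval_seq_row -hf; apply: h2 => v Sv; have : V (seq_row (n + n) v) := Sv.
  by rewrite VW => hv; rewrite hf -meval_seq_row; exact: hv.
have := h3; rewrite /H rmorphM mulf_eq0 negb_or hg => /andP[+ _].
by rewrite (eq_evi F (w := z)).
Qed.

Theorem theorem1p1 (R : realType) (j : R[i] -> R[i]) (hj : is_modular_j j)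
    (n : nat) (hn : (1 <= n)%N) (V : set 'rV[R[i]]_(n + n))
    (hV : irreducible_variety V)
    (hdense : zariski_dense (proj_first n @` V)) :
  zariski_dense (proj_first n @` (graph_j j n `&` V)) /\
  infinite_set (graph_j j n `&` V).
Proof.
split; first by apply: zariski_denseP => f f0; exact: dense_solutions hj hV hdense f0.
move=> /finite_seqP[s hs].
have [X hX] := @itpolyX R[i] n 0 hn.
have /choice[c hc] : forall e, exists f : itpoly _ n,
    forall v : nat -> R[i], evi v n f = e by move=> e; exact: itpolyC.
(* Were the solutions finite in number, this nonzero polynomial in $z_1$ would vanish at all of
   them. *)
pose F := \prod_(p <- s) (X - c (p ord0 (lshift n (Ordinal hn)))).
have F0 : F != 0.
  rewrite prodf_seq_neq0; apply/allP => p _; apply/implyP => _; apply/eqP => h.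
  have := congr1 (evi (fun=> p ord0 (lshift n (Ordinal hn)) + 1) n) h.
  rewrite rmorphB /= hX hc rmorph0 addrAC subrr add0r => /eqP.
  by rewrite oner_eq0.
have [v [p pGV pv]] := dense_solutions hj hV hdense F0.
have ps : p \in s by move: pGV; rewrite hs.
rewrite rmorph_prod prodf_seq_neq0 => /allP/(_ p ps)/=; rewrite rmorphB /= hX hc.
have /rowP/(_ (Ordinal hn)) := pv; rewrite !mxE /= => ->.
by rewrite subrr eqxx.
Qed.
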